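(* Let $\eta:\{A,B,C\}^*\to\{A,B,C\}^*$ be a primitive substitution (primitive morphism) fixing a non-degenerate 3iet word $u$. Then there exist Sturmian morphisms $\varphi,\psi:\{0,1\}^*\to\{0,1\}^*$ having fixed points, such that $\varphi\propto\psi$ and $\eta$ or $\eta^2$ is equal to $\mathrm{ter}(\varphi,\psi)$.
   Context: Words and morphisms: $\mathcal A^*$ is the free monoid of finite words over a finite alphabet $\mathcal A$. A morphism $\xi:\mathcal A^*\to\mathcal B^*$ is a monoid homomorphism; it acts on right-sided, left-sided and bidirectional infinite words letter by letter, and in the bidirectional case $\xi(\cdots u_{-2}u_{-1}|u_0u_1\cdots)=\cdots\xi(u_{-2})\xi(u_{-1})|\xi(u_0)\xi(u_1)\cdots$. A fixed point of $\xi:\mathcal A^*\to\mathcal A^*$ is an infinite word $u$ with $\xi(u)=u$ (one says $\xi$ fixes $u$). The matrix $M_\xi$ has entries $(M_\xi)_{ab}=$ number of letters $b$ in $\xi(a)$; $\xi$ is primitive if some power of $M_\xi$ has all entries positive. 3iet words: let $\varepsilon,l,c$ be real numbers with $\varepsilon\in(0,1)$ irrational, $\max\{\varepsilon,1-\varepsilon\}<l<1$ and $0\in I:=[c,c+l)$. Let $T:I\to I$ be $T(x)=x+1-\varepsilon$ for $x\in I_A:=[c,c+l-1+\varepsilon)$, $T(x)=x+1-2\varepsilon$ for $x\in I_B:=[c+l-1+\varepsilon,c+\varepsilon)$, $T(x)=x-\varepsilon$ for $x\in I_C:=[c+\varepsilon,c+l)$. The 3iet word with parameters $\varepsilon,l,c$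 is the bidirectional word $(u_n)_{n\in\mathbb Z}$ over $\{A,B,C\}$ with $u_n=X$ if and only if $T^n(0)\in I_X$, $X\in\{A,B,C\}$. It is non-degenerate if it has exactly $2n+1$ distinct factors of length $n$ for every $n\in\mathbb N$; equivalently, $l\notin\mathbb Z+\varepsilon\mathbb Z$. Sturmian words: a right-sided (or left-sided) infinite word is Sturmian if for every $n\in\mathbb N$ it has exactly $n+1$ distinct factors of length $n$; a bidirectional word is Sturmian if it is uniformly recurrent (for every factor $w$, only finitely many factors $wv$ of the word are such that $w$ is not a factor of $v$) and it has exactly $n+1$ factors of length $n$ for every $n$. A Sturmian morphism is a morphism $\{0,1\}^*\to\{0,1\}^*$ mapping every Sturmian word over $\{0,1\}$ to a Sturmian word. Amicability: let $\sigma_{01},\sigma_{10}:\{A,B,C\}^*\to\{0,1\}^*$ be the morphisms $\sigma_{01}: A\mapsto 0,\ B\mapsto 01,\ C\mapsto 1$ and $\sigma_{10}: A\mapsto 0,\ B\mapsto 10,\ C\mapsto 1$. For finite or infinite words $u,v$ over $\{0,1\}$, $u$ is amicable to $v$, written $u\propto v$, if there is a word $w$ over $\{A,B,C\}$ with $u=\sigma_{01}(w)$ and $v=\sigma_{10}(w)$; then $w=:\mathrm{ter}(u,v)$ is called the ternarization of $u$ and $v$ (it is uniquely determined). For morphisms $\varphi,\psi:\{0,1\}^*\to\{0,1\}^*$, $\varphi\propto\psi$ means $\varphi(0)\propto\psi(0)$, $\varphi(1)\propto\psi(1)$ and $\varphi(01)\propto\psi(10)$; the ternarization $\mathrm{ter}(\varphi,\psi)$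 is the morphism on $\{A,B,C\}^*$ with $A\mapsto\mathrm{ter}(\varphi(0),\psi(0))$, $B\mapsto\mathrm{ter}(\varphi(01),\psi(10))$, $C\mapsto\mathrm{ter}(\varphi(1),\psi(1))$. *)

(* Defs.v *)
From HB Require Import structures.
From mathcomp Require Import all_boot all_order all_algebra.
From mathcomp Require Import all_classical all_reals.

Set Implicit Arguments.
Unset Strict Implicit.
Unset Printing Implicit Defensive.

Import Order.TTheory GRing.Theory Num.Theory.

Local Open Scope classical_set_scope.

(* The binary alphabet {0,1} is [bool], with 0 = false and 1 = true. *)

Inductive abc := A | B | C.

Definition abc_code (x : abc) : option bool :=
  match x with A => Some false | B => None | C => Some true end.
Definition abc_decode (x : option bool) : abc :=
  match x with Some false => A | None => B | Some true => C end.
Lemma abc_codeK : cancel abc_code abc_decode. Proof. by case. Qed.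
HB.instance Definition _ := Finite.copy abc (can_type abc_codeK).

(* Since seq X is the free monoid on X, a morphism X^* -> Y^* is given by the
   images of the letters; [mext f] is the corresponding monoid homomorphism. *)
Definition wmorph (X Y : Type) := X -> seq Y.
Definition mext {X Y : Type} (f : wmorph X Y) (w : seq X) : seq Y :=
  flatten (map f w).
Definition mcomp {X Y Z : Type} (g : wmorph Y Z) (f : wmorph X Y) :
  wmorph X Z := fun x => mext g (f x).

Definition incidence {X Y : finType} (f : wmorph X Y) : 'M[nat]_(#|X|, #|Y|) :=
  (\matrix_(i, j) count_mem (enum_val j) (f (enum_val i)))%R.

Definition primitive_morphism {X : finType} (f : wmorph X X) : Prop :=
  exists2 k, 0 < k & forall i j, 0 < (incidence f ^+ k)%R i j.

(* A right-sided word is u_0 u_1 u_2 ...; a left-sided word is ... u_2 u_1 u_0;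
   a bidirectional word is ... u_(-2) u_(-1) | u_0 u_1 ... *)
Definition rword (X : Type) := nat -> X.
Definition lword (X : Type) := nat -> X.
Definition biword (X : Type) := int -> X.

Definition rhalf {X : Type} (u : biword X) : rword X := fun n => u (Posz n).
(* Negz n is -(n+1). *)
Definition lhalf {X : Type} (u : biword X) : lword X := fun n => u (Negz n).

Definition rprefix {X : Type} (u : rword X) (n : nat) : seq X := mkseq u n.
Definition lsuffix {X : Type} (u : lword X) (n : nat) : seq X :=
  rev (mkseq u n).

(* [*_image f u v] means that the word f(u) is infinite (in the relevant
   directions) and equal to v. *)
Definition r_image {X Y : Type} (f : wmorph X Y) (u : rword X) (v : rword Y) :=
  (forall n, let w := mext f (rprefix u n) in w = rprefix v (size w)) /\
  (forall m, exists n, m <= size (mext f (rprefix u n))).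

Definition l_image {X Y : Type} (f : wmorph X Y) (u : lword X) (v : lword Y) :=
  (forall n, let w := mext f (lsuffix u n) in w = lsuffix v (size w)) /\
  (forall m, exists n, m <= size (mext f (lsuffix u n))).

Definition bi_image {X Y : Type} (f : wmorph X Y)
    (u : biword X) (v : biword Y) :=
  l_image f (lhalf u) (lhalf v) /\ r_image f (rhalf u) (rhalf v).

Definition fixes {X : Type} (f : wmorph X X) (u : biword X) := bi_image f u u.

Definition r_factor {X : Type} (u : rword X) : set (seq X) :=
  [set w | exists i : nat, w = mkseq (fun k => u (i + k)) (size w)].
Definition l_factor {X : Type} (u : lword X) : set (seq X) :=
  [set w | exists i : nat, w = rev (mkseq (fun k => u (i + k)) (size w))].
Definition bi_factor {X : Type} (u : biword X) : set (seq X) :=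
  [set w | exists i : int, w = mkseq (fun k => u (i + Posz k)%R) (size w)].

Definition complexity {X : finType} (L : set (seq X)) (n : nat) : nat :=
  #|[pred w : n.-tuple X | `[< L (tval w) >]]|.

Definition uniformly_recurrent {X : finType} (u : biword X) : Prop :=
  forall w, bi_factor u w ->
    finite_set [set v : seq X | bi_factor u (w ++ v) /\ ~~ infix w v].

Definition r_sturmian (u : rword bool) : Prop :=
  forall n, complexity (r_factor u) n = n.+1.
Definition l_sturmian (u : lword bool) : Prop :=
  forall n, complexity (l_factor u) n = n.+1.
Definition bi_sturmian (u : biword bool) : Prop :=
  uniformly_recurrent u /\ forall n, complexity (bi_factor u) n = n.+1.

Definition sturmian_morphism (f : wmorph bool bool) : Prop :=
  [/\ forall u, r_sturmian u -> exists2 v, r_image f u v & r_sturmian v,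
      forall u, l_sturmian u -> exists2 v, l_image f u v & l_sturmian v &
      forall u, bi_sturmian u -> exists2 v, bi_image f u v & bi_sturmian v].

Section ThreeIntervalExchange.
Local Open Scope ring_scope.
Variable R : realType.
Implicit Types e l c x y : R.

Definition iet_dom l c : set R := [set` `[c, c + l[].

Definition iet_int e l c (X : abc) : set R :=
  match X with
  | A => [set` `[c, c + l - 1 + e[]
  | B => [set` `[c + l - 1 + e, c + e[]
  | C => [set` `[c + e, c + l[]
  end.

(* Only the restriction to [iet_dom l c] is meaningful. *)
Definition iet_map e l c x : R :=
  if x < c + l - 1 + e then x + 1 - e
  else if x < c + e then x + 1 - 2 * e
  else x - e.

(* y = T^n x for the bijection T = iet_map e l c of iet_dom l c. *)
Definition iet_iter e l c (n : int) x y : Prop :=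
  match n with
  | Posz m => y = iter m (iet_map e l c) x
  | Negz m => iet_dom l c y /\ iter m.+1 (iet_map e l c) y = x
  end.

Definition is_3iet_word e l c (u : biword abc) : Prop :=
  [/\ 0 < e < 1 /\ irrational e,
      Num.max e (1 - e) < l < 1,
      iet_dom l c 0 &
      forall n X, u n = X <-> exists2 y, iet_iter e l c n 0 y & iet_int e l c X y].

End ThreeIntervalExchange.

Definition nondegenerate_3iet (u : biword abc) : Prop :=
  forall n, complexity (bi_factor u) n = n.*2.+1.

Definition sigma01 : wmorph abc bool := fun x =>
  match x with
  | A => [:: false] | B => [:: false; true] | C => [:: true]
  end.
Definition sigma10 : wmorph abc bool := fun x =>
  match x with
  | A => [:: false] | B => [:: true; false] | C => [:: true]
  end.

Definition is_ternarization (u v : seq bool) (w : seq abc) : Prop :=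
  u = mext sigma01 w /\ v = mext sigma10 w.

Lemma is_ternarization_inj u v w1 w2 :
  is_ternarization u v w1 -> is_ternarization u v w2 -> w1 = w2.
Proof.
move=> [-> ->] []; elim: w1 w2 => [|x w1 IH] [|y w2]; rewrite /mext //=.
- by case: y.
- by case: x.
by case: x y => [] [] //= [h1] [h2]; congr (_ :: _); apply: IH.
Qed.

Definition amicable (u v : seq bool) : Prop := exists w, is_ternarization u v w.

Definition ter (u v : seq bool) : seq abc := xget [::] (is_ternarization u v).

Definition amicable_morph (f g : wmorph bool bool) : Prop :=
  [/\ amicable (f false) (g false), amicable (f true) (g true) &
      amicable (mext f [:: false; true]) (mext g [:: true; false])].

Definition ter_morph (f g : wmorph bool bool) : wmorph abc abc := fun x =>
  match x with
  | A => ter (f false) (g false)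
  | B => ter (mext f [:: false; true]) (mext g [:: true; false])
  | C => ter (f true) (g true)
  end.

(* Main.v *)
Require Import Defs.
From mathcomp Require Import all_boot all_order all_algebra.
From mathcomp Require Import all_classical all_reals.
From mathcomp Require Import zify ring lra.

(** Let T be the exchange, with the discontinuities b = c + l - 1 + e and d = c + e, and
    give to the letters A, B, C the weights 1 - e, 1 - 2 e, - e by which T translates, so
    that T^n 0 is the weight of the prefix of length n of u. The points just on the left
    of b read AC and those just on the right read B, after which they are neighbours
    again; at d they read B and CA. Non-degeneracy means that the orbits of b and d are
    disjoint ([nondegenerate_apart], by counting factors). So neighbours whose orbits
    pass on the two sides of a discontinuity separate for two steps and, for a time as
    long as wished if they are close enough, never again.

    The weights of the words eta(a) define a function f on the letters, whose sums along u
    are weights of prefixes of u, hence bounded. Bounded sums force f B = f A + f C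
    ([bounded_sums_additive], in the spirit of the theorem of Kesten on bounded remainder
    sets), and then f is k times the weight for some k, nonzero because eta is not
    erasing. So eta sends the point T^n 0 to its multiple by k, and the neighbours of b to
    neighbours of k b. There one reads eta(AC) on one side and eta(B) on the other, two
    words of the same weight; hence they differ in at most one place, where one has AC and
    the other B, or one B and the other CA ([read_around]). The same holds for eta(B) and
    eta(CA) at k d. Counting the letters B shows that one of the two pairs differs in the
    first way and the other in the second ([eta_splits]).

    Let phi map 0 and 1 to the images by sigma01 of eta(A) and eta(C), and let psi be
    the same with sigma10. Since sigma01 identifies AC with B and sigma10 identifies CA
    with B, either sigma01 carries eta to phi and sigma10 carries it to psi, and eta is
    the ternarization of phi and psi; or eta exchanges the roles of sigma01 and sigma10,
    and eta^2 is the ternarization of the composites of phi and psi. The images of u by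
    sigma01 and sigma10 are the fixed points.

    In both cases phi(01) and phi(10) differ by the exchange of two adjacent letters. A
    morphism with this property is a composite of a renaming of the letters and of
    morphisms which write a letter a before, or after, each occurrence of the other letter:
    the Euclidean algorithm on the lengths of the two images ([swaps_once_split]). Each of
    these preserves the languages, extendable on both sides, which have exactly one right
    special word of each length ([before_special]), and these are the languages of
    Sturmian words. *)

Set Implicit Arguments.
Unset Strict Implicit.
Unset Printing Implicit Defensive.

Import Order.TTheory GRing.Theory Num.Theory.


(** * Morphisms acting on finite and infinite words *)

Lemma mext_cat (X Y : Type) (f : wmorph X Y) w1 w2 :
  mext f (w1 ++ w2) = mext f w1 ++ mext f w2.
Proof. by rewrite /mext map_cat flatten_cat. Qed.

Lemma mext_cons (X Y : Type) (f : wmorph X Y) a w : mext f (a :: w) = f a ++ mext f w.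
Proof. by []. Qed.

Lemma mext1 (X Y : Type) (f : wmorph X Y) a : mext f [:: a] = f a.
Proof. by rewrite /mext /= cats0. Qed.

Lemma mext2 (X Y : Type) (f : wmorph X Y) a a' : mext f [:: a; a'] = f a ++ f a'.
Proof. by rewrite mext_cons mext1. Qed.

Lemma mext_mcomp (X Y Z : Type) (f : wmorph X Y) (g : wmorph Y Z) w :
  mext (mcomp g f) w = mext g (mext f w).
Proof.
elim: w => // a w IH.
by rewrite (mext_cons (mcomp g f)) (mext_cons f) mext_cat IH.
Qed.

Lemma eq_mext (X Y : Type) (f f' : wmorph X Y) : f =1 f' -> mext f =1 mext f'.
Proof. by move=> E w; rewrite /mext (eq_map E). Qed.

Definition nonerasing (X : Type) (Y : eqType) (f : wmorph X Y) := forall a, f a != [::].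

Lemma size_mext (X : Type) (Y : eqType) (f : wmorph X Y) w : nonerasing f -> size w <= size (mext f w).
Proof.
move=> fN; elim: w => // a w IH; rewrite mext_cons size_cat /=.
by have := fN a; rewrite -size_eq0; lia.
Qed.

Section Morphisms.
Variables X Y Z : eqType.
Implicit Types (f : wmorph X Y) (g : wmorph Y Z).

Lemma mext_infix f w1 w2 : infix w1 w2 -> infix (mext f w1) (mext f w2).
Proof.
by case/infixP=> p [q ->]; rewrite !mext_cat; apply/infixP; exists (mext f p), (mext f q).
Qed.

Lemma size_mext_cat f w1 w2 : size (mext f w1) <= size (mext f (w1 ++ w2)).
Proof. by rewrite mext_cat size_cat leq_addr. Qed.

Lemma nonerasing_mcomp f g : nonerasing f -> nonerasing g -> nonerasing (mcomp g f).
Proof.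
move=> fN gN a; rewrite /mcomp -size_eq0 -lt0n.
by apply: leq_trans (size_mext _ gN); rewrite lt0n size_eq0.
Qed.

(** The mirror image of a morphism: it acts on right-sided words as the
    original one acts on their mirror images, which are left-sided. *)
Definition mirror f : wmorph X Y := fun a => rev (f a).

Lemma mirror_mext f w : mext (mirror f) w = rev (mext f (rev w)).
Proof.
elim: w => // a w IH.
by rewrite mext_cons IH rev_cons -cats1 mext_cat mext1 rev_cat.
Qed.

Lemma nonerasing_mirror f : nonerasing f -> nonerasing (mirror f).
Proof. by move=> fN a; rewrite /mirror -size_eq0 size_rev size_eq0. Qed.

End Morphisms.

Lemma mkseqD (X : Type) (u : nat -> X) n m :
  mkseq u (n + m) = mkseq u n ++ mkseq (fun k => u (n + k)) m.
Proof. by rewrite /mkseq iotaD map_cat add0n -[n in iota n m]addn0 iotaDl -map_comp. Qed.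

Lemma rprefixD (X : Type) (u : rword X) n m :
  rprefix u (n + m) = rprefix u n ++ mkseq (fun k => u (n + k)) m.
Proof. exact: mkseqD. Qed.

Lemma mkseq_cons (X : Type) (u : nat -> X) n :
  mkseq u n.+1 = u 0 :: mkseq (fun k => u k.+1) n.
Proof. exact: (mkseqD u 1 n). Qed.

Lemma size_rprefix (X : Type) (u : rword X) n : size (rprefix u n) = n.
Proof. exact: size_mkseq. Qed.

Lemma nth_rprefix (X : Type) (u : rword X) n x i : i < n -> nth x (rprefix u n) i = u i.
Proof. by move=> ?; rewrite nth_mkseq. Qed.

Lemma r_factorP (X : eqType) (u : rword X) w :
  r_factor u w <-> exists n, infix w (rprefix u n).
Proof.
split=> [[i wE]|[n /infixP[p [q E]]]].
  by exists (i + size w); rewrite rprefixD -wE; apply/infixP; exists (rprefix u i), [::]; rewrite cats0.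
exists (size p).
have := congr1 size E; rewrite size_rprefix !size_cat => nE.
have : take (size w) (drop (size p) (rprefix u n)) = w.
  by rewrite E drop_size_cat // take_size_cat.
by rewrite nE rprefixD drop_size_cat ?size_rprefix // /mkseq -map_take take_iota;
   have -> : minn (size w) (size w + size q) = size w by lia.
Qed.

Section RightImages.
Variables X Y Z : eqType.
Implicit Types (f : wmorph X Y) (g : wmorph Y Z).

Lemma r_image_unique f u v v' : r_image f u v -> r_image f u v' -> v =1 v'.
Proof.
move=> [h1 hu] [h2 _] i; have [n ni] := hu i.+1.
have := h1 n; rewrite /= {1}(h2 n) => E.
by rewrite -(nth_rprefix v (v i) ni) -E nth_rprefix.
Qed.

Lemma r_image_exists f u : nonerasing f -> exists v, r_image f u v.
Proof.
move=> fN; pose P n := mext f (rprefix u n).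
have PS n : n <= size (P n) by rewrite -{1}(size_rprefix u n) size_mext.
have y0 : Y by have := fN (u 0); case: (f (u 0)).
have Ple n m : n <= m -> exists s, P m = P n ++ s.
  by move=> /subnKC <-; rewrite /P rprefixD mext_cat; eexists.
exists (fun i => nth y0 (P i.+1) i); split=> [n /=|m]; last by exists m.
apply: (@eq_from_nth _ y0) => [|i iP]; first by rewrite size_rprefix.
rewrite nth_rprefix //; case: (leqP n i.+1) => [/Ple[s ->]|/ltnW/Ple[s]]; rewrite -/(P n).
  by rewrite nth_cat iP.
by move=> ->; rewrite nth_cat PS.
Qed.

Lemma r_image_comp f g u v w :
  r_image f u v -> r_image g v w -> r_image (mcomp g f) u w.
Proof.
move=> [h1 hu1] [h2 hu2]; split=> [n|m] /=.
  by rewrite mext_mcomp h1 -h2.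
have [k km] := hu2 m; have [n nk] := hu1 k; exists n.
rewrite mext_mcomp h1 -(subnKC nk) rprefixD.
exact: leq_trans km (size_mext_cat _ _ _).
Qed.

Lemma r_image_factor f u v w : r_image f u v ->
  r_factor v w <-> exists2 x, r_factor u x & infix w (mext f x).
Proof.
move=> [h hu]; split=> [/r_factorP[n wn]|[x /r_factorP[n xn] wx]]; last first.
  apply/r_factorP; exists (size (mext f (rprefix u n))).
  by rewrite -h; apply: infix_trans wx (mext_infix _ xn).
have [k nk] := hu n; exists (rprefix u k); first by apply/r_factorP; exists k; apply: infix_refl.
apply: infix_trans wn _; rewrite h -(subnKC nk) rprefixD.
by apply/infixP; exists [::]; eexists.
Qed.

Lemma l_image_mirror f u v : l_image f u v <-> r_image (mirror f) u v.
Proof.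
have E n : mext f (lsuffix u n) = rev (mext (mirror f) (rprefix u n)).
  by rewrite mirror_mext revK.
split=> -[h hu]; split=> [n|m] /=.
- by have := h n; rewrite /= E size_rev => /(can_inj revK).
- by have [n] := hu m; rewrite E size_rev; exists n.
- by rewrite E size_rev {1}h.
- by have [n] := hu m; exists n; rewrite E size_rev.
Qed.

End RightImages.

Lemma l_factor_rev (X : eqType) (u : lword X) w : l_factor u w <-> r_factor u (rev w).
Proof.
split=> -[i E]; exists i; first by rewrite {1}E revK size_rev.
by rewrite -[LHS]revK {1}E size_rev.
Qed.

Lemma mcomp_mirror (X Y Z : eqType) (f : wmorph X Y) (g : wmorph Y Z) :
  mirror (mcomp g f) =1 mcomp (mirror g) (mirror f).
Proof. by move=> a; rewrite /mcomp mirror_mext /mirror revK. Qed.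

(** Half-words are numbered away from the origin; the windows around the origin are
    what a bidirectional image is computed on. *)
Definition window (X : Type) (u : biword X) n m :=
  lsuffix (lhalf u) n ++ rprefix (rhalf u) m.

Lemma windowE (X : Type) (u : biword X) n m :
  window u n m = mkseq (fun k => u (Posz k - Posz n)%R) (n + m).
Proof.
case: n => [|n].
  by rewrite /window /= add0n; apply: eq_mkseq => k; rewrite /rhalf subr0.
rewrite /window /lsuffix; apply: (@eq_from_nth _ (u 0%R)).
  by rewrite size_cat size_rev !size_mkseq.
move=> i; rewrite size_cat size_rev !size_mkseq => im.
rewrite [RHS]nth_mkseq // nth_cat size_rev size_mkseq.
case: ltnP => ni; first rewrite nth_rev ?size_mkseq // nth_mkseq /lhalf; try lia.
  by congr u; lia.
by rewrite nth_rprefix /rhalf; [congr u; lia|lia].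
Qed.

Lemma window_infix (X : eqType) (u : biword X) n m n' m' :
  n <= n' -> m <= m' -> infix (window u n m) (window u n' m').
Proof.
move=> nn mm; rewrite /window -(subnKC mm) -(subnKC nn) rprefixD.
have -> : lsuffix (lhalf u) (n + (n' - n)) = rev (mkseq (fun k => lhalf u (n + k)) (n' - n)) ++ lsuffix (lhalf u) n.
  by rewrite -rev_cat -rprefixD.
by apply/infixP; do 2 eexists; rewrite -!catA; congr (_ ++ (_ ++ _)).
Qed.

Lemma bi_factorP (X : eqType) (u : biword X) w :
  bi_factor u w <-> exists n, infix w (window u n n).
Proof.
split=> [[i wE]|[n]].
  exists (absz i + size w)%N; rewrite windowE.
  set N := (absz i + size w)%N.
  have [a aE] : exists a : nat, (Posz a = i + Posz N)%R by exists (absz (i + Posz N)%R); rewrite /N; lia.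
  have aN : a + size w <= N + N by rewrite /N in aE *; lia.
  apply/infixP; exists (mkseq (fun k => u (Posz k - Posz N)%R) a).
  exists (mkseq (fun k => u (Posz (a + size w + k) - Posz N)%R) (N + N - (a + size w))).
  pose g k := u (Posz k - Posz N)%R.
  have wg : w = mkseq (fun k => g (a + k)) (size w).
    by rewrite {1}wE; apply: eq_mkseq => k; rewrite /g; congr u; lia.
  have := rprefixD g (a + size w) (N + N - (a + size w)).
  by rewrite subnKC // (rprefixD g a) -wg -catA.
rewrite windowE => /(ex_intro (fun k => infix w (rprefix (fun k => u (Posz k - Posz n)%R) k)) _).
move/(r_factorP (fun k => u (Posz k - Posz n)%R) w) => [i wE].
exists (Posz i - Posz n)%R; rewrite {1}wE; apply: eq_mkseq => k; congr u; lia.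
Qed.

Section BiImages.
Variables X Y Z : eqType.
Implicit Types (f : wmorph X Y) (g : wmorph Y Z).

Lemma bi_image_unique f u v v' : bi_image f u v -> bi_image f u v' -> v =1 v'.
Proof.
move=> [/l_image_mirror l1 r1] [/l_image_mirror l2 r2] [] n.
- exact: (r_image_unique r1 r2 n).
- exact: (r_image_unique l1 l2 n).
Qed.

Lemma bi_image_exists f u : nonerasing f -> exists v, bi_image f u v.
Proof.
move=> fN; have [r hr] := r_image_exists (rhalf u) fN.
have [l hl] := r_image_exists (lhalf u) (nonerasing_mirror fN).
by exists (fun i => match i with Posz n => r n | Negz n => l n end); split => //; apply/l_image_mirror.
Qed.

Lemma bi_image_comp f g u v w :
  bi_image f u v -> bi_image g v w -> bi_image (mcomp g f) u w.
Proof.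
move=> [/l_image_mirror l1 r1] [/l_image_mirror l2 r2]; split; last exact: r_image_comp r1 r2.
apply/l_image_mirror; have -> : mirror (mcomp g f) = mcomp (mirror g) (mirror f).
  by apply/funext; apply: mcomp_mirror.
exact: r_image_comp l1 l2.
Qed.

Lemma bi_image_factor f u v w : bi_image f u v ->
  bi_factor v w <-> exists2 x, bi_factor u x & infix w (mext f x).
Proof.
move=> [[hl hlu] [hr hru]].
have E n m : mext f (window u n m) =
    window v (size (mext f (lsuffix (lhalf u) n))) (size (mext f (rprefix (rhalf u) m))).
  by rewrite /window mext_cat {1}hl {1}hr.
split=> [/bi_factorP[n wn]|[x /bi_factorP[n xn] wx]]; last first.
  have := infix_trans wx (mext_infix f xn); rewrite E.
  set a := size _; set b := size _ => h; apply/bi_factorP; exists (a + b).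
  by apply: infix_trans h (window_infix _ _ _); rewrite ?leq_addr ?leq_addl.
have [a na] := hlu n; have [b nb] := hru n.
exists (window u (a + b) (a + b)); first by apply/bi_factorP; exists (a + b); apply: infix_refl.
apply: infix_trans wn _; apply: infix_trans (mext_infix f (window_infix u (leq_addr b a) (leq_addl a b))).
by rewrite E; apply: window_infix.
Qed.

End BiImages.


(** * Languages with one right special word of each length *)

Definition factorial_lang (L : set (seq bool)) := forall w x, infix w x -> L x -> L w.
Definition right_ext (L : set (seq bool)) := forall w, L w -> exists c, L (rcons w c).
Definition left_ext (L : set (seq bool)) := forall w, L w -> exists c, L (c :: w).
Definition right_special (L : set (seq bool)) : set (seq bool) :=
  [set w | L (rcons w false) /\ L (rcons w true)].

(** A word has two right extensions if it is right special, and one otherwise. *)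
Lemma complexityS L n : factorial_lang L -> right_ext L ->
  complexity L n.+1 = complexity L n + complexity (right_special L) n.
Proof.
move=> Lf Lr; rewrite /complexity -!sum1_card.
pose F (w : seq bool) := if `[< L w >] then 1 else 0.
have H0 (M : set (seq bool)) k :
    \sum_(t in [pred w : k.-tuple bool | `[< M (tval w) >]]) 1 =
    \sum_(t : k.-tuple bool) (if `[< M t >] then 1 else 0).
  by rewrite [LHS]big_mkcond.
rewrite !H0.
have -> : \sum_(t : n.+1.-tuple bool) (if `[< L t >] then 1 else 0) =
    \sum_(t : n.-tuple bool) \sum_(c : bool) F (rcons t c).
  rewrite pair_bigA /= (reindex (fun p : n.-tuple bool * bool => [tuple of rcons p.1 p.2])) //=.
  exists (fun t : n.+1.-tuple bool => ([tuple of belast (thead t) (behead t)], last (thead t) (behead t))).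
    move=> [t c] _; congr pair; last first.
      by rewrite /thead (tnth_nth false) /=; case: t => -[|x t] //= _; rewrite last_rcons.
    apply/val_inj => /=; rewrite /thead (tnth_nth false) /=; case: t => -[|x t] //= _.
    by rewrite belast_rcons.
  move=> t _; apply/val_inj => /=; rewrite -lastI /thead (tnth_nth false) /=.
  by case: t => -[].
rewrite -big_split /=; apply: eq_bigr => t _; rewrite big_bool /F /right_special /=.
have cons_sub c : L (rcons t c) -> L t.
  by apply: Lf; rewrite -cats1; apply/infixP; exists [::], [:: c].
case: (asboolP (L t)) => Lt; last first.
  by do 3 (case: asboolP => [|_]; first by (move=> /cons_sub // || move=> [/cons_sub])).
have [c] := Lr _ Lt.
by case: c => Lc; do 3 case: asboolP => //; intuition.
Qed.

Lemma complexity1P (L : set (seq bool)) n : complexity L n = 1 <->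
  (exists2 w, size w = n & L w) /\
  (forall w w', size w = n -> size w' = n -> L w -> L w' -> w = w').
Proof.
rewrite /complexity; split=> [/eqP/card1P[t tE]|[[w wn Lw] Lu]].
  have inE0 (w : n.-tuple bool) : L w <-> w = t.
    have := tE w; rewrite !inE => E.
    split=> [Lw|->]; last by have := tE t; rewrite !inE eqxx => /asboolP.
    by apply/eqP; rewrite -E; apply/asboolP.
  split; first by exists t; [rewrite size_tuple|exact/inE0].
  move=> w w' wn wn' Lw Lw'; have E1 : Tuple (introT eqP wn) = t by apply/inE0.
  have E2 : Tuple (introT eqP wn') = t by apply/inE0.
  by have := congr1 val (etrans E1 (esym E2)).
apply/eqP/card1P; exists (Tuple (introT eqP wn)) => t; rewrite !inE.
apply/asboolP/eqP => [Lt|-> //]; apply/val_inj => /=; apply: Lu => //; exact: size_tuple.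
Qed.

Record sturmian_lang (L : set (seq bool)) : Prop := SturmianLang {
  sturm_fact : factorial_lang L;
  sturm_rext : right_ext L;
  sturm_lext : left_ext L;
  sturm_cplx : forall n, complexity L n = n.+1 }.

Lemma complexity0 (L : set (seq bool)) : complexity L 0 = 1 <-> L [::].
Proof.
rewrite complexity1P; split=> [[[w /size0nil->]]//|L0].
by split; [exists [::]|move=> w w' /size0nil-> /size0nil->].
Qed.

Lemma sturmian_special L : factorial_lang L -> right_ext L ->
  (forall n, complexity L n = n.+1) <->
  L [::] /\ forall n, complexity (right_special L) n = 1.
Proof.
move=> Lf Lr; split=> [h|[/complexity0 h0 h] ]; last first.
  by elim=> [//|n IH]; rewrite complexityS // IH h addn1.
split; first exact/complexity0.
by move=> n; have := complexityS n Lf Lr; rewrite !h; lia.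
Qed.

Definition image_lang (f : wmorph bool bool) (L : set (seq bool)) : set (seq bool) :=
  [set w | exists2 x, L x & infix w (mext f x)].

Lemma image_lang_comp f g L : image_lang (mcomp f g) L = image_lang f (image_lang g L).
Proof.
apply/seteqP; split=> w /= [x Lx].
  rewrite mext_mcomp => wx; exists (mext g x) => //; exists x => //; exact: infix_refl.
move=> wx; case: Lx => y Ly xy; exists y => //; rewrite mext_mcomp.
exact: infix_trans wx (mext_infix f xy).
Qed.

Lemma image_lang_factorial f L : factorial_lang (image_lang f L).
Proof. by move=> w x wx [y Ly xy]; exists y => //; apply: infix_trans wx xy. Qed.

Lemma image_lang_rext f L : nonerasing f -> right_ext L -> right_ext (image_lang f L).
Proof.
move=> fN Lr w [x Lx /infixP[p [[|c q] E]]].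
  have [c Lc] := Lr _ Lx; have := fN c; case fc: (f c) => [//|d s] _.
  exists d, (rcons x c) => //; rewrite -!cats1 mext_cat mext1 fc E cats0.
  by apply/infixP; exists p, s; rewrite -!catA.
exists c, x => //; rewrite E; apply/infixP; exists p, q.
by rewrite -cats1 -!catA.
Qed.

Lemma image_lang_lext f L : nonerasing f -> left_ext L -> left_ext (image_lang f L).
Proof.
move=> fN Ll w [x Lx /infixP[p [q]]]; case: (lastP p) => [|p' c] E.
  have [c Lc] := Ll _ Lx; have := fN c; case/lastP fc: (f c) => [//|s d] _.
  exists d, (c :: x) => //; rewrite mext_cons fc E.
  by apply/infixP; exists s, q; rewrite cat_rcons.
exists c, x => //; rewrite E; apply/infixP; exists p', q.
by rewrite cat_rcons.
Qed.

(** * The elementary Sturmian morphisms *)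

(** With the renamings of the letters they generate all Sturmian morphisms. *)
Definition before (a : bool) : wmorph bool bool :=
  fun c => if c == a then [:: a] else [:: a; c].
Definition after (a : bool) : wmorph bool bool :=
  fun c => if c == a then [:: a] else [:: c; a].

Lemma before_nonerasing a : nonerasing (before a).
Proof. by move=> c; rewrite /before; case: ifP. Qed.

Lemma before_after a w : mext (before a) w ++ [:: a] = a :: mext (after a) w.
Proof.
elim: w => // c w IH; rewrite !mext_cons -catA IH /before /after.
by case: eqP.
Qed.

(** The two morphisms are conjugate by a letter, so that they have the same
    effect on a language whose words extend on both sides. *)
Lemma image_lang_after a L : right_ext L -> left_ext L ->
  image_lang (after a) L = image_lang (before a) L.
Proof.
move=> Lr Ll; apply/seteqP; split=> w /= [x Lx wx].
  have [c Lc] := Lr _ Lx; exists (rcons x c) => //; rewrite -cats1 mext_cat mext1.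
  have -> : before a c = a :: behead (before a c) by rewrite /before; case: eqP.
  apply: infix_trans wx _; rewrite -cat1s catA before_after.
  by apply/infixP; exists [:: a], (behead (before a c)).
have [c Lc] := Ll _ Lx; exists (c :: x) => //; rewrite mext_cons.
have [s ->] : exists s, after a c = rcons s a.
  by rewrite /after; case: eqP => _; [exists [::]|exists [:: c]].
rewrite cat_rcons -before_after; apply: infix_trans wx _.
by apply/infixP; exists s, [:: a].
Qed.

(** The letter which follows an [a] tells whether this [a] is the image of [a] or the
    beginning of the image of the other letter, and what precedes it is decoded
    without ambiguity. *)
Lemma before_parse a c x s q : s ++ [:: a; c] ++ q = mext (before a) x ->
  exists x2 x3, x = x2 ++ c :: x3 /\ s = mext (before a) x2.
Proof.
elim: {x}(size x) {-2}x (leqnn (size x)) s => [|n IH] [|d x] sx s //; try by case: s.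
rewrite mext_cons {1}/before; case: eqP => [->|/eqP da].
  case: s => [[]|e s [-> E]] /=.
    by case: x sx => [//|e x] _; rewrite mext_cons /before; case: eqP => [<- [-> _]|_ [-> _]];
       exists [::]; eexists.
  have [|x2 [x3 [-> ->]]] := IH x _ s E; first by rewrite /= in sx; lia.
  by exists (a :: x2), x3; split => //; rewrite mext_cons /before eqxx.
case: s => [[-> E]|e [[_ ad]|e' s [-> -> E]]] /=.
- by exists [::]; eexists.
- by rewrite ad eqxx in da.
- have [|x2 [x3 [-> ->]]] := IH x _ s E; first by rewrite /= in sx; lia.
  by exists (d :: x2), x3; split => //; rewrite mext_cons /before (negbTE da).
Qed.

Lemma before_isolated a d s q x : s ++ [:: d; ~~ a] ++ q = mext (before a) x -> d = a.
Proof.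
elim: {x}(size x) {-2}x (leqnn (size x)) s => [|n IH] [|e x] sx s //; try by case: s.
rewrite mext_cons {1}/before; case: eqP => [_|/eqP ea].
  by case: s => [[]//|e' s [_ E]]; apply: (IH x) E; rewrite /= in sx; lia.
case: s => [[]//|e' [[_ _ ]|e'' s [_ _ E]]]; last by apply: (IH x) E; rewrite /= in sx; lia.
case: x sx => // c x _; rewrite mext_cons /before.
by case: eqP => _ [] /eqP; rewrite -addbT -{2}[a]addbF (inj_eq (@addbI a)).
Qed.

Lemma suffix_size_eq (T : eqType) (s1 s2 t : seq T) :
  suffix s1 t -> suffix s2 t -> size s1 = size s2 -> s1 = s2.
Proof. by rewrite !suffixE => /eqP<- /eqP<-; rewrite !size_drop => E; congr drop; lia. Qed.

Lemma suffix_le (T : eqType) (s1 s2 t : seq T) :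
  suffix s1 t -> suffix s2 t -> size s1 <= size s2 -> suffix s1 s2.
Proof.
rewrite !suffixE => /eqP E1 /eqP E2 le; rewrite -{2}E1 -{2}E2 drop_drop.
have := congr1 size E1; have := congr1 size E2; rewrite !size_drop => h2 h1.
by apply/eqP; congr drop; lia.
Qed.

Lemma before_common_suffix a x y : exists z, [/\ suffix z x, suffix z y &
  forall v, suffix v (mext (before a) x) -> suffix v (mext (before a) y) ->
            suffix v (mext (before a) z)].
Proof.
elim/last_ind: x y => [|x c IH] y.
  by exists [::]; split; rewrite ?suffix0s.
case/lastP: y => [|y c']; first by exists [::]; split; rewrite ?suffix0s.
rewrite -!cats1 !mext_cat !mext1; have [<-|cc] := eqVneq c c'.
  have [z [zx zy zP]] := IH y; exists (z ++ [:: c]); split.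
  - by case/suffixP: zx => p ->; rewrite -catA suffix_suffix.
  - by case/suffixP: zy => p ->; rewrite -catA suffix_suffix.
  move=> v vx vy; rewrite mext_cat mext1.
  case: (leqP (size v) (size (before a c))) => vc.
    exact: suffix_catr (suffix_le vx (suffix_suffix _ _) vc).
  have /suffixP[v' vE] := suffix_le (suffix_suffix _ _) vx (ltnW vc).
  move: vx vy; rewrite vE !suffix_catl // eqxx /=; exact: zP.
exists [::]; split; rewrite ?suffix0s // => v.
have E d : exists s, before a d = rcons s d.
  by rewrite /before; case: eqP => [->|_]; [exists [::]|exists [:: a]].
have [s ->] := E c; have [s' ->] := E c'; rewrite -!rcons_cat.
case/lastP: v => [|v d]; first by rewrite !suffix0s.
by rewrite !suffix_rcons => /andP[/eqP-> _] /andP[/eqP cE]; rewrite cE eqxx in cc.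
Qed.

Lemma right_special_suffix L z z' : factorial_lang L ->
  suffix z z' -> right_special L z' -> right_special L z.
Proof.
move=> Lf /suffixP[p ->] [L0 L1]; split; [apply: Lf L0|apply: Lf L1];
  by apply/infixP; exists p, [::]; rewrite cats0 rcons_cat.
Qed.

(** A nonempty right special word of the image ends with [a], and what precedes this [a]
    is a suffix of the image of a right special word. As right special words are
    suffixes of one another, there is one of each length. *)
Lemma before_special a L : sturmian_lang L ->
  forall n, complexity (right_special (image_lang (before a) L)) n = 1.
Proof.
move=> [Lf Lr Ll Lc]; have [L0 Ls] := (sturmian_special Lf Lr).1 Lc.
set L' := image_lang _ _.
have L's c x : L' x -> infix c x -> L' c by move=> h1 h2; apply: image_lang_factorial h2 h1.
have special a' w : right_special L w -> L (rcons w a') by move=> [h0 h1]; case: a'.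
have specialI w : L' (w ++ [:: a]) -> L' (w ++ [:: ~~ a]) -> right_special L' w.
  by rewrite /right_special /= -!cats1; case: (a) => h1 h2; split.
have specialE w : right_special L' w -> L' (w ++ [:: a]) /\ L' (w ++ [:: ~~ a]).
  by rewrite /right_special /= -!cats1 => -[]; case: (a).
have specialL w : L (rcons w a) -> L (rcons w (~~ a)) -> right_special L w.
  by case: (a) => h1 h2; split.
have baE : before a a = [:: a] by rewrite /before eqxx.
have bbE : before a (~~ a) = [:: a; ~~ a].
  by rewrite /before; rewrite -addbT -[X in _ == X]addbF (inj_eq (@addbI a)).
have decode w : right_special L' (rcons w a) -> exists2 z, right_special L z & suffix w (mext (before a) z).
  move=> /specialE[]; rewrite -!cats1 -!catA /= => -[x Lx /infixP[p [q xE]]] [y Ly /infixP[p' [q' yE]]].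
  have [x2 [x3 [xE2 pE]]] : exists x2 x3, x = x2 ++ a :: x3 /\ p ++ w = mext (before a) x2.
    by apply: (@before_parse _ _ _ _ q); rewrite xE -!catA.
  have [y2 [y3 [yE2 pE']]] : exists x2 x3, y = x2 ++ ~~ a :: x3 /\ p' ++ w = mext (before a) x2.
    by apply: (@before_parse _ _ _ _ q'); rewrite yE -!catA.
  have [z [zx zy zP]] := before_common_suffix a x2 y2.
  exists z; last by apply: zP; rewrite -?pE -?pE' suffix_suffix.
  apply: specialL.
    case/suffixP: zx => r rE; apply: Lf Lx; apply/infixP; exists r, x3.
    by rewrite xE2 rE -cats1 -!catA.
  case/suffixP: zy => r rE; apply: Lf Ly; apply/infixP; exists r, y3.
  by rewrite yE2 rE -cats1 -!catA.
have ends w d : right_special L' (rcons w d) -> d = a.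
  move=> /specialE[_]; rewrite -!cats1 -!catA => -[x _ /infixP[p [q E]]].
  by apply: (@before_isolated a d (p ++ w) q x); rewrite E -!catA.
move=> n; apply/complexity1P; split.
  case: n => [|n].
    have /complexity1P[[w /size0nil-> [Lt Lf']] _] := Ls 0.
    have Lb : L [:: ~~ a] by case: (a).
    exists [::] => //; apply: specialI; exists [:: ~~ a] => //; rewrite mext1 bbE.
      by apply/infixP; exists [::], [:: ~~ a].
    by apply/infixP; exists [:: a], [::].
  have /complexity1P[[z zn zs] _] := Ls n.
  have nle : n <= size (mext (before a) z) by rewrite -zn size_mext //; apply: before_nonerasing.
  set k := size (mext (before a) z) - n.
  exists (rcons (drop k (mext (before a) z)) a); first by rewrite size_rcons size_drop /k; lia.
  have E := cat_take_drop k (mext (before a) z).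
  apply: specialI.
    have [c Lc'] := Lr _ (special a z zs); exists (rcons (rcons z a) c) => //.
    rewrite -!cats1 !mext_cat !mext1 -{2}E baE.
    have -> : before a c = a :: behead (before a c) by rewrite /before; case: eqP.
    by apply/infixP; do 2 eexists; rewrite -!catA /=.
  exists (rcons z (~~ a)); first exact: special.
  rewrite -!cats1 !mext_cat !mext1 -{2}E bbE.
  by apply/infixP; exists (take k (mext (before a) z)), [::]; rewrite -!catA /=.
move=> w w'; case: n => [|n]; first by move=> /size0nil-> /size0nil->.
case/lastP: w => // w d; case/lastP: w' => // w' d'; rewrite !size_rcons => -[wn] -[wn'] ws ws'.
have dE := ends _ _ ws; have dE' := ends _ _ ws'; subst d d'; congr rcons.
have [z zs wz] := decode _ ws; have [z' zs' wz'] := decode _ ws'.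
wlog le : w w' z z' wn wn' ws ws' zs zs' wz wz' / size z <= size z'.
  by move=> H; case: (leqP (size z) (size z')) => [|/ltnW]; [apply: H|move=> h; apply/esym; apply: H h].
have zE : z = drop (size z' - size z) z'.
  have /complexity1P[_ Lu] := Ls (size z); apply: Lu => //.
    by rewrite size_drop; lia.
  apply: right_special_suffix zs' => //; apply/suffixP; exists (take (size z' - size z) z').
  by rewrite cat_take_drop.
apply: suffix_size_eq wz' _; last by rewrite wn wn'.
rewrite -(cat_take_drop (size z' - size z) z') -zE mext_cat.
exact: suffix_catr.
Qed.

Lemma sturmian_before a L : sturmian_lang L -> sturmian_lang (image_lang (before a) L).
Proof.
move=> SL; have [Lf Lr Ll Lc] := SL.
have fL := @image_lang_factorial (before a) L.
have rL := image_lang_rext (@before_nonerasing a) Lr.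
split=> //; first exact: (image_lang_lext (@before_nonerasing a) Ll).
apply/sturmian_special => //; split; last exact: before_special.
exists [::]; first exact/complexity0.
exact: infix_refl.
Qed.

Lemma sturmian_after a L : sturmian_lang L -> sturmian_lang (image_lang (after a) L).
Proof.
move=> SL; have [_ Lr Ll _] := SL.
by rewrite image_lang_after //; apply: sturmian_before.
Qed.


Lemma eq_complexity (X : finType) (L L' : set (seq X)) n :
  (forall w, size w = n -> L w <-> L' w) -> complexity L n = complexity L' n.
Proof.
move=> E; apply: eq_card => w; rewrite !inE.
by apply/asboolP/asboolP => /(E _ (size_tuple w)).
Qed.

Lemma complexity_bij (X : finType) (L : set (seq X)) (h : seq X -> seq X) n :
  (forall w, size (h w) = size w) -> involutive h ->
  complexity [set w | L (h w)]%classic n = complexity L n.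
Proof.
move=> hs hK.
have hn (t : n.-tuple X) : size (h t) == n by rewrite hs size_tuple.
pose g (t : n.-tuple X) : n.-tuple X := Tuple (hn t).
have gK : involutive g by move=> t; apply/val_inj => /=; rewrite hK.
rewrite /complexity.
transitivity #|[preim g of [pred w : n.-tuple X | `[< L w >]]]|; first exact: eq_card.
rewrite card_preim; last exact: (can_inj gK).
apply: eq_card => t; rewrite !inE; suff -> : t \in codom g by [].
by apply/codomP; exists (g t); rewrite gK.
Qed.

Definition renaming (s : bool) : wmorph bool bool := fun c => [:: c (+) s].

Lemma sturmian_renaming s L : sturmian_lang L -> sturmian_lang (image_lang (renaming s) L).
Proof.
move=> [Lf Lr Ll Lc].
have E w : mext (renaming s) w = map (fun c => c (+) s) w.
  by elim: w => //= c w <-.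
have K : involutive (map (fun c => c (+) s)).
  by move=> w; rewrite -map_comp map_id_in // => c _ /=; rewrite -addbA addbb addbF.
have L'E : image_lang (renaming s) L = [set w | L (map (fun c => c (+) s) w)]%classic.
  apply/seteqP; split=> w /= => [[x Lx /infixP[p [q]]]|Lw].
    rewrite E => xE; apply: Lf Lx; apply/infixP; exists (map (fun c => c (+) s) p), (map (fun c => c (+) s) q).
    by rewrite -!map_cat -xE K.
  by exists (map (fun c => c (+) s) w) => //; rewrite E K infix_refl.
have rN : nonerasing (renaming s) by [].
split; [exact: image_lang_factorial|exact: image_lang_rext|exact: image_lang_lext|].
by move=> n; rewrite L'E complexity_bij // => w; rewrite size_map.
Qed.

(** * Words with [n.+1] factors of each length *)

Lemma r_factor_factorial u : factorial_lang (r_factor u).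
Proof.
by move=> w x wx /r_factorP[n xn]; apply/r_factorP; exists n; apply: infix_trans wx xn.
Qed.

Lemma r_factor_rext u : right_ext (r_factor u).
Proof.
move=> w [i wE]; exists (u (i + size w)), i.
by rewrite size_rcons mkseqS -wE.
Qed.

(** If [w] occurs only at the beginning, then removing the first letter leaves a
    word with at most [n] factors of length [n = size w], hence, as in the
    theorem of Morse and Hedlund, without right special factors of some length,
    hence with a bounded number of factors; but it has lost at most one factor
    of each length. *)
Lemma r_sturmian_lext u : r_sturmian u -> left_ext (r_factor u).
Proof.
move=> uS w wu; apply: contrapT => /forallNP wN.
pose u' n := u n.+1.
have u'u x : r_factor u' x -> r_factor u x.
  by move=> [i xE]; exists i.+1; rewrite {1}xE; apply: eq_mkseq => k; rewrite /u' addSn.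
have wu' : ~ r_factor u' w.
  move=> [i wE]; apply: (wN (u i)); exists i.
  rewrite /= mkseq_cons addn0 {1}wE; congr cons; apply: eq_mkseq => k.
  by rewrite /u' addnS.
have u'f := @r_factor_factorial u'; have u're := @r_factor_rext u'.
set p' := complexity (r_factor u').
have p'le n : n <= p' n.
  suff : complexity (r_factor u) n <= p' n + 1 by rewrite uS; lia.
  have un : size (rprefix u n) == n by rewrite size_rprefix.
  rewrite /p' /complexity addnC -(card1 (Tuple un)) -cardUI.
  apply: leq_trans (leq_addr _ _); apply: subset_leq_card; apply/fintype.subsetP => t.
  rewrite !inE => -[i tE]; apply/orP; case: i tE => [|i] tE; [left|right].
    by apply/eqP/val_inj; rewrite /= {1}tE size_tuple.
  by apply/asboolP; exists i; rewrite {1}tE; apply: eq_mkseq => k; rewrite /u' addSn.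
have p'w : p' (size w) <= size w.
  suff : p' (size w) < complexity (r_factor u) (size w) by rewrite uS; lia.
  apply: proper_card; apply/fintype.properP; split.
    by apply/fintype.subsetP => t; rewrite !inE => h; apply: u'u.
  by exists (in_tuple w); rewrite inE //=; apply/negP => /asboolP.
have p'0 : p' 0 = 1 by apply/complexity0; exists 0.
have p'S n : p' n.+1 = p' n + complexity (right_special (r_factor u')) n.
  exact: complexityS.
case: (pselect (exists n, complexity (right_special (r_factor u')) n = 0)) => [[n rn]|rN].
  have rm m : n <= m -> complexity (right_special (r_factor u')) m = 0.
    move=> nm; apply/eqP; rewrite -leqn0 leqNgt; apply/negP => /card_gt0P[t].
    rewrite inE => tS.
    have := card0_eq rn; have dn : size (drop (m - n) t) == n by rewrite size_drop size_tuple; lia.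
    move=> /(_ (Tuple dn)); rewrite inE /= => /asboolP; apply.
    apply: right_special_suffix tS => //; apply/suffixP; exists (take (m - n) t).
    by rewrite cat_take_drop.
  have pc m : p' (n + m) = p' n.
    by elim: m => [|m IH]; rewrite ?addn0 // addnS p'S rm ?leq_addr // IH addn0.
  by have := p'le (n + (p' n).+1); rewrite pc; lia.
suff H n : n < p' n by have := H (size w); lia.
elim: n => [|n IH]; rewrite ?p'0 // p'S.
have : complexity (right_special (r_factor u')) n != 0 by apply/eqP => E; apply: rN; exists n.
lia.
Qed.

Lemma r_sturmian_lang u : r_sturmian u <-> sturmian_lang (r_factor u).
Proof.
split=> [uS|[_ _ _]//]; split=> //.
- exact: r_factor_factorial.
- exact: r_factor_rext.
- exact: r_sturmian_lext.
Qed.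

Lemma l_sturmian_r u : l_sturmian u <-> r_sturmian u.
Proof.
have E n : complexity (l_factor u) n = complexity (r_factor u) n.
  rewrite -(complexity_bij (r_factor u) n (@size_rev _) (@revK _)).
  by apply: eq_complexity => w _; apply: l_factor_rev.
by split=> h n; rewrite -(h n) E.
Qed.

Lemma bi_factor_factorial u : factorial_lang (bi_factor u).
Proof.
by move=> w x wx /bi_factorP[n xn]; apply/bi_factorP; exists n; apply: infix_trans wx xn.
Qed.

Lemma bi_sturmian_lang u : (forall n, complexity (bi_factor u) n = n.+1) <->
  sturmian_lang (bi_factor u).
Proof.
split=> [uS|[_ _ _]//]; split=> //; first exact: bi_factor_factorial.
- move=> w [i wE]; exists (u (i + Posz (size w))%R), i.
  by rewrite size_rcons mkseqS -wE.
- move=> w [i wE]; exists (u (i - 1)%R), (i - 1)%R.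
  rewrite /= mkseq_cons addr0.
  by congr cons; rewrite {1}wE; apply: eq_mkseq => k; congr u; lia.
Qed.

(** * Uniform recurrence *)

Lemma finite_short (X : finType) (S : set (seq X)) N :
  (forall v, S v -> size v <= N) -> finite_set S.
Proof.
move=> SN; apply: (@sub_finite_set _ _ [set bseqval t | t in [set: N.-bseq X]]%classic).
  by move=> v /SN vN; exists (Bseq vN).
by apply: finite_image; apply: finite_finset.
Qed.

Lemma finite_bounded (X : finType) (S : set (seq X)) : finite_set S ->
  exists N, forall v, S v -> size v <= N.
Proof.
move=> /finite_seqP[s ->]; exists (\max_(v <- s) size v) => v /= vs.
exact: (leq_bigmax_seq (F := size) v).
Qed.

Lemma mext_cover (X Y : eqType) (f : wmorph X Y) x p w q : nonerasing f ->
  p ++ w ++ q = mext f x ->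
  exists x1 x2 x3 s t, [/\ x = x1 ++ x2 ++ x3, size x2 <= (size w).+1,
    mext f x2 = s ++ w ++ t & q = t ++ mext f x3].
Proof.
move=> fN; elim: x p => [|c x IH] p E.
  have /= := congr1 size E; rewrite !size_cat; case: w E => //=; last by move=> *; lia.
  move=> E sz; have -> : q = [::] by apply/size0nil; lia.
  by exists [::], [::], [::], [::], [::].
case: (leqP (size (f c)) (size p)) => fp.
  have pE : p = f c ++ drop (size (f c)) p.
    rewrite -{1}(cat_take_drop (size (f c)) p); congr (_ ++ _).
    have := congr1 (take (size (f c))) E; rewrite mext_cons (take_size_cat _ (erefl (size (f c)))) => fE; rewrite -[RHS]fE.
    rewrite take_cat; case: ltnP => // h.
    by have -> : size (f c) - size p = 0 by [lia]; rewrite take0 cats0 take_oversize.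
  move: E; rewrite {1}pE mext_cons -catA => /eqP; rewrite eqseq_cat // eqxx /= => /eqP/IH.
  by move=> [x1 [x2 [x3 [s [t [-> *]]]]]]; exists (c :: x1), x2, x3, s, t.
pose x2 := c :: take (size w) x.
exists [::], x2, (drop (size w) x), p.
have xE : c :: x = x2 ++ drop (size w) x by rewrite /x2 /= cat_take_drop.
rewrite xE mext_cat in E.
have le : size (p ++ w) <= size (mext f x2).
  case: (leqP (size x) (size w)) => h.
    have := congr1 size E; rewrite drop_oversize // cats0 => <-.
    by rewrite catA [X in _ <= X]size_cat leq_addr.
  rewrite /x2 mext_cons !size_cat.
  have := size_mext (take (size w) x) fN; rewrite size_take h; lia.
exists (drop (size (p ++ w)) (mext f x2)).
have tE : take (size (p ++ w)) (mext f x2) = p ++ w.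
  have := congr1 (take (size (p ++ w))) E; rewrite catA take_size_cat // take_cat.
  case: ltnP le => // h1 h2 ->.
  by have -> : size (p ++ w) - size (mext f x2) = 0 by [lia];
     rewrite take0 cats0 take_oversize //.
have x2E : mext f x2 = p ++ w ++ drop (size (p ++ w)) (mext f x2).
  by rewrite catA -{1}tE cat_take_drop.
split=> //; first by rewrite /x2 /= size_take_min; lia.
move/eqP: E; rewrite {1}x2E -!catA !eqseq_cat // !eqxx /= => /eqP.
done.
Qed.

(** An occurrence of a factor [w] of the image is contained in the image of a short word,
    which comes back after a bounded time and brings [w] back with it. *)
Lemma uniformly_recurrent_image (X Y : finType) (f : wmorph X Y) u v :
  nonerasing f -> bi_image f u v -> uniformly_recurrent u -> uniformly_recurrent v.
Proof.
move=> fN uv ur w wv.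
have /choice[N NP] : forall x, exists N, bi_factor u x -> forall y,
    bi_factor u (x ++ y) -> ~~ infix x y -> size y <= N.
  move=> x; case: (pselect (bi_factor u x)) => [ux|]; last by exists 0.
  have [N NP] := finite_bounded (ur x ux); exists N => _ y h1 h2; exact: NP.
pose K := \max_(i < (size w).+2) \max_(t : i.-tuple X) N t.
have KP x : size x <= (size w).+1 -> N x <= K.
  rewrite -ltnS => xs; apply: leq_trans (leq_bigmax (Ordinal xs)).
  exact: (leq_bigmax (F := fun t : (size x).-tuple X => N t) (in_tuple x)).
pose M := \max_(c : X) size (f c).
have MP y : size (mext f y) <= size y * M.
  elim: y => // c y IH; rewrite mext_cons size_cat mulSn leq_add //; exact: leq_bigmax.
apply: (@finite_short _ _ ((size w).+1 * M + K.+1 * M)) => z [wz wNz].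
rewrite leqNgt; apply/negP => zbig; move/negP: wNz; apply.
have [x ux /infixP[p [q xE]]] := (bi_image_factor (w ++ z) uv).1 wz.
rewrite -catA in xE; have [x1 [x2 [x3 [s [t [xE2 x2s x2E qE]]]]]] := mext_cover fN (esym xE).
have fact y : infix y x -> bi_factor u y.
  by move=> yx; move/bi_factorP: ux => [n xn]; apply/bi_factorP; exists n; apply: infix_trans yx xn.
have x2u : bi_factor u x2 by apply: fact; apply/infixP; exists x1, x3.
have x2M : size t <= (size w).+1 * M.
  apply: (@leq_trans (size (mext f x2))); first by rewrite x2E !size_cat addnA leq_addl.
  by apply: leq_trans (MP _) _; rewrite leq_mul2r x2s orbT.
pose y := take K.+1 x3.
have yM : size (mext f y) <= K.+1 * M.
  apply: leq_trans (MP _) _; rewrite leq_mul2r; apply/orP; right.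
  by rewrite /y size_take_min; lia.
have ftz : size (t ++ mext f y) <= size z by rewrite size_cat; apply: leq_trans (leq_add x2M yM) (ltnW zbig).
have sy : size y = K.+1.
  rewrite /y size_take; case: ltnP => // h.
  have : size z <= size t + size (mext f y).
    by rewrite /y take_oversize // -size_cat -qE size_cat leq_addr.
  by move=> /(leq_trans zbig)/leq_trans/(_ (leq_add x2M yM)); rewrite ltnn.
have x2y : infix x2 y.
  apply/negPn/negP => xN.
  have : bi_factor u (x2 ++ y).
    apply: fact; apply/infixP; exists x1, (drop K.+1 x3).
    by rewrite xE2 -!catA cat_take_drop.
  by move=> /(NP _ x2u)/(_ xN); rewrite sy; have := KP _ x2s; lia.
have [r ->] : exists r, z = t ++ mext f y ++ r.
  exists (drop (size (t ++ mext f y)) z); rewrite catA -{1}(cat_take_drop (size (t ++ mext f y)) z); congr (_ ++ _).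
  have := congr1 (take (size (t ++ mext f y))) qE.
  rewrite -(cat_take_drop K.+1 x3) mext_cat catA (take_size_cat _ (erefl (size (t ++ mext f y)))) take_cat.
  case: ltnP => [_ ->//|h E]; rewrite -[RHS]E take_oversize //.
  by move: ftz; rewrite -subn_eq0 => /eqP->; rewrite take0 cats0.
apply: (@infix_trans _ (mext f y)).
  by apply: infix_trans (mext_infix f x2y); rewrite x2E; apply/infixP; exists s, t.
by apply/infixP; exists t; eexists.
Qed.


(** * Sturmian morphisms *)

Definition swapped (v w : seq bool) := exists d w1 w2,
  v = w1 ++ [:: d; ~~ d] ++ w2 /\ w = w1 ++ [:: ~~ d; d] ++ w2.

Lemma swapped_sym v w : swapped v w -> swapped w v.
Proof. by move=> [d [w1 [w2 [-> ->]]]]; exists (~~ d), w1, w2; rewrite negbK. Qed.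

(** This is the shape which a morphism inherits from an interval exchange: the orbits
    of two points on the two sides of a discontinuity separate for two steps. *)
Definition swaps_once (f : wmorph bool bool) :=
  swapped (f false ++ f true) (f true ++ f false).

Lemma neqb (a : bool) : (~~ a == a) = false. Proof. by case: a. Qed.
Lemma eqbn (a : bool) : (a == ~~ a) = false. Proof. by case: a. Qed.

Lemma swaps_onceE f a :
  swaps_once f <-> swapped (f a ++ f (~~ a)) (f (~~ a) ++ f a).
Proof. by case: a; split=> // /swapped_sym. Qed.

Lemma swaps_once_mirror f : swaps_once f -> swaps_once (mirror f).
Proof.
move=> [d [w1 [w2 [E1 E2]]]]; exists d, (rev w2), (rev w1); rewrite /mirror.
by rewrite -!rev_cat E1 E2 !rev_cat -!catA.
Qed.

Lemma swaps_once_nonerasing f : swaps_once f -> nonerasing f.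
Proof.
move=> fS a; apply/eqP => fa; have [d [w1 [w2 [E1 E2]]]] := (swaps_onceE f a).1 fS.
move: E1 E2; rewrite fa cats0 cat0s => -> /eqP; rewrite eqseq_cat // eqxx /=.
by rewrite eqseq_cons eqbn.
Qed.

(** When [f (~~ a)] is the longer image, the place of the swap is far enough
    from one of the ends for [f a] to be split off [f (~~ a)] on this side: the
    Euclidean algorithm. *)
Lemma swaps_once_split f : swaps_once f ->
  (exists s, f = renaming s) \/
  exists a f', [/\ swaps_once f', f = mcomp f' (before a) \/ f = mcomp f' (after a) &
    size (f' false) + size (f' true) < size (f false) + size (f true)].
Proof.
move=> fS; have fN := swaps_once_nonerasing fS.
have [a ale] : exists a, size (f a) <= size (f (~~ a)).
  by case: (leqP (size (f true)) (size (f false))) => [|/ltnW] h; [exists true|exists false].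
have [d [w1 [w2 []]]] := (swaps_onceE f a).1 fS.
have fsz (g : wmorph bool bool) : size (g false) + size (g true) = size (g a) + size (g (~~ a)).
  by case: (a) => //; rewrite addnC.
have := fN a; have := ale; set X := f (~~ a); set Y := f a => YX Y0 E1 E2.
pose f' X' c := if c == a then Y else X'.
have shrink X' : size X = size Y + size X' ->
    size (f' X' false) + size (f' X' true) < size (f false) + size (f true).
  move=> E; rewrite !fsz -/X -/Y E /f' eqxx neqb.
  by case: (Y) Y0 => //= y Y' _; lia.
have ffE X' g : g a = [:: a] -> (f (~~ a) = mext (f' X') (g (~~ a))) -> f = mcomp (f' X') g.
  move=> ga gb; apply/funext => c; rewrite /mcomp; have [->|ca] := eqVneq c a.
    by rewrite ga mext1 /f' eqxx.
  by have -> : c = ~~ a by case: c a ca {X Y ale E1 E2 YX Y0 f' shrink fsz ga gb} => -[].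
have [Yw1|w1Y] := leqP (size Y) (size w1).
  right; have w1E : w1 = Y ++ drop (size Y) w1.
    rewrite -{1}(cat_take_drop (size Y) w1); congr (_ ++ _).
    by have := congr1 (take (size Y)) E1; rewrite take_size_cat // takel_cat.
  move: E1 E2; rewrite w1E -!catA => /eqP; rewrite eqseq_cat // eqxx /= => /eqP E1 E2.
  have XE : X = Y ++ drop (size Y) X.
    rewrite -{1}(cat_take_drop (size Y) X); congr (_ ++ _).
    by have := congr1 (take (size Y)) E2; rewrite takel_cat // take_size_cat.
  exists a, (f' (drop (size Y) X)); split.
  - apply/(swaps_onceE _ a); exists d, (drop (size Y) w1), w2; rewrite /f' eqxx neqb -XE; split=> //.
    by move: E2; rewrite {1}XE -!catA => /eqP; rewrite eqseq_cat // eqxx /= => /eqP.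
  - left; apply: ffE; rewrite /before ?eqxx // neqb mext_cons mext1 /f' eqxx neqb.
    exact: XE.
  - by apply: shrink; rewrite {1}XE size_cat.
have [Yw2|w2Y] := leqP (size Y) (size w2).
  right.
  have suf s t s' t' : s ++ t = s' ++ t' :> seq bool -> size t <= size t' ->
      t' = take (size t' - size t) t' ++ t.
    move=> E le; rewrite -{1}(cat_take_drop (size t' - size t) t'); congr (_ ++ _).
    apply: (@suffix_size_eq _ _ _ (s ++ t)); rewrite ?suffix_suffix //.
      by rewrite E; apply: suffix_catr; apply/suffixP; exists (take (size t' - size t) t'); rewrite cat_take_drop.
    by rewrite size_drop subKn.
  have w2E : w2 = take (size w2 - size Y) w2 ++ Y.
    by apply: (suf X Y (w1 ++ [:: ~~ d; d]) w2) => //; rewrite E2 -catA.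
  have XE : X = take (size X - size Y) X ++ Y.
    apply: (suf (w1 ++ [:: d; ~~ d] ++ take (size w2 - size Y) w2) Y Y X) => //.
    by rewrite E1 -!catA -w2E.
  have canc (s t : seq bool) : s ++ Y = t ++ Y -> s = t.
    by move=> /eqP; rewrite -(inj_eq (can_inj revK)) !rev_cat eqseq_cat // eqxx /= (inj_eq (can_inj revK)) => /eqP.
  exists a, (f' (take (size X - size Y) X)); split.
  - apply/(swaps_onceE _ a); exists d, w1, (take (size w2 - size Y) w2); rewrite /f' eqxx neqb; split.
      by apply: canc; rewrite -!catA -XE -w2E.
    by rewrite -XE; apply: canc; rewrite -!catA -w2E.
  - right; apply: ffE; rewrite /after ?eqxx // neqb mext_cons mext1 /f' eqxx neqb.
    exact: XE.
  - by apply: shrink; rewrite {1}XE size_cat addnC.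
left; have [szY szX] : size Y = (size w1).+1 /\ size X = (size w1).+1.
  by have := congr1 size E1; rewrite !size_cat /=; lia.
have [YE XE] : Y = w1 ++ [:: d] /\ X = ~~ d :: w2.
  move: E1; rewrite (_ : w1 ++ _ = (w1 ++ [:: d]) ++ ~~ d :: w2) -?catA // catA => /eqP.
  rewrite eqseq_cat; last by rewrite szY size_cat /= addn1.
  by move=> /andP[/eqP-> /eqP->].
have [XE' YE'] : X = w1 ++ [:: ~~ d] /\ Y = d :: w2.
  move: E2; rewrite (_ : w1 ++ _ = (w1 ++ [:: ~~ d]) ++ d :: w2) -?catA // catA => /eqP.
  rewrite eqseq_cat; last by rewrite szX size_cat /= addn1.
  by move=> /andP[/eqP-> /eqP->].
case: w1 {E1 E2 w1Y szY szX} YE XE' => [|h w1] YE XE'; last first.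
  by move: YE XE'; rewrite YE' XE => -[<- _] []/eqP; rewrite neqb.
exists (d (+) a); apply/funext => c; rewrite /renaming; have [->|ca] := eqVneq c a.
  by rewrite -/Y YE addbC addbK.
have -> : c = ~~ a by case: c a ca {X Y YX Y0 f' shrink fsz ffE ale w2Y YE XE YE' XE'} => -[].
by rewrite -/X XE'; case: (a) (d) => -[].
Qed.

Lemma swaps_once_sturmian_lang f L : swaps_once f ->
  sturmian_lang L -> sturmian_lang (image_lang f L).
Proof.
have [n] := ubnP (size (f false) + size (f true)).
elim: n f L => // n IH f L fn fS SL.
have [[s ->]|[a [f' [f'S fE lt]]]] := swaps_once_split fS.
  exact: sturmian_renaming.
by case: fE => fE; rewrite fE image_lang_comp; apply: IH => //; first (by lia);
  [apply: sturmian_before|by lia|apply: sturmian_after].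
Qed.

Lemma swaps_once_r_sturmian f u : swaps_once f -> r_sturmian u ->
  exists2 v, r_image f u v & r_sturmian v.
Proof.
move=> fS /r_sturmian_lang uS; have fN := swaps_once_nonerasing fS.
have [v uv] := r_image_exists u fN; exists v => //.
apply/r_sturmian_lang; suff -> : r_factor v = image_lang f (r_factor u).
  exact: swaps_once_sturmian_lang.
by apply/seteqP; split=> w /(r_image_factor w uv).
Qed.

Lemma swaps_once_sturmian f : swaps_once f -> sturmian_morphism f.
Proof.
move=> fS; split=> [u|u|u [ur uS]]; first exact: swaps_once_r_sturmian.
  move=> /l_sturmian_r uS.
  have [v uv vS] := swaps_once_r_sturmian (swaps_once_mirror fS) uS.
  by exists v; [apply/l_image_mirror|apply/l_sturmian_r].
have fN := swaps_once_nonerasing fS.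
have [v uv] := bi_image_exists u fN; exists v => //; split.
  exact: uniformly_recurrent_image uv ur.
apply/bi_sturmian_lang; suff -> : bi_factor v = image_lang f (bi_factor u).
  by apply: swaps_once_sturmian_lang => //; apply/bi_sturmian_lang.
by apply/seteqP; split=> w /(bi_image_factor w uv).
Qed.

Lemma sturmian_mcomp f g : sturmian_morphism f -> sturmian_morphism g ->
  sturmian_morphism (mcomp g f).
Proof.
move=> [fr fl fb] [gr gl gb]; split=> u uS.
- have [v uv vS] := fr u uS; have [w vw wS] := gr v vS.
  by exists w => //; apply: r_image_comp uv vw.
- have [v uv vS] := fl u uS; have [w vw wS] := gl v vS.
  exists w => //; apply/l_image_mirror; have -> : mirror (mcomp g f) = mcomp (mirror g) (mirror f).
    by apply/funext; apply: mcomp_mirror.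
  by apply: r_image_comp; apply/l_image_mirror; eassumption.
- have [v uv vS] := fb u uS; have [w vw wS] := gb v vS.
  by exists w => //; apply: bi_image_comp uv vw.
Qed.


(** * Density of the multiples of an irrational number modulo 1 *)

Section Kronecker.
Local Open Scope ring_scope.
Variables (R : realType) (x : R).
Hypothesis x_irr : irrational x.

Lemma irrational_comb (m : int) (n : nat) : (0 < n)%N -> m%:~R + n%:R * x != 0.
Proof.
move=> n0; apply/eqP => E; apply: x_irr; apply/rationalP; exists (- m), n.
have nN : n%:R != 0 :> R by rewrite pnatr_eq0; lia.
apply: (mulfI nN); rewrite [RHS]mulrC divfK // rmorphN.
lra.
Qed.

(** From a multiple at a distance [t] of the integers one gets another one at a
    distance at most [t / 2], because one of the two multiples of [t] around [1] is
    so close to [1]. *)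
Lemma small_comb (k : nat) : exists (m : int) (n : nat),
  [/\ (0 < n)%N, 0 < `|m%:~R + n%:R * x| < 1 & `|m%:~R + n%:R * x| * (2 ^ k)%:R <= 1].
Proof.
elim: k => [|k [m [n [n0 /andP[y0 y1] yk]]]].
  exists (- Num.floor x), 1%N.
  have f0 : (- Num.floor x)%:~R + 1%:R * x != 0 by exact: irrational_comb.
  rewrite normr_gt0 f0 rmorphN mul1r /= mulr1.
  have := floor_itv x => /andP[h1 h2].
  have xf : 0 <= - (Num.floor x)%:~R + x < 1 by move: h2; rewrite intrD; lra.
  by rewrite ger0_norm //; case/andP: xf => // *; split=> //; lra.
set y := m%:~R + n%:R * x in y0 y1 yk; set t := `|y| in y0 y1 yk.
have [s [s1 ts]] : exists s : int, (s%:~R * s%:~R = 1 :> R) /\ t = s%:~R * y.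
  rewrite /t; case: (ger0P y) => _; [exists 1|exists (-1)]; rewrite ?rmorphN ?rmorph1; split; ring.
have /truncn_itv := ltW (y0 : 0 < t); have := y0; rewrite -invr_gt0 => /ltW/truncn_itv.
set j := Num.trunc _ => /andP[j1 j2] _.
have {}j1 : j%:R * t <= 1 by rewrite -ler_pdivlMr // mul1r.
have {}j2 : 1 < j.+1%:R * t by rewrite -ltr_pdivrMr // mul1r.
have j0 : (0 < j)%N by rewrite lt0n; apply/eqP => E; move: j2; rewrite E; lra.
have step i : (0 < i)%N -> `|i%:R * t - 1| = `|(m *+ i - s)%:~R + (i * n)%:R * x| /\ i%:R * t - 1 != 0.
  move=> i0; have E : i%:R * t - 1 = s%:~R * ((m *+ i - s)%:~R + (i * n)%:R * x).
    by rewrite ts /y rmorphB /= rmorphMn /= natrM -mulr_natl -[X in _ - X]s1; ring.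
  have sn : `|s%:~R| = 1 :> R.
    apply/eqP; rewrite -sqrp_eq1 // -normrX expr2 s1 normr1 //.
  split; first by rewrite E normrM sn mul1r.
  rewrite E mulf_neq0 //; first by rewrite -normr_gt0 sn.
  by apply: irrational_comb; rewrite muln_gt0 i0.
have yk2 i : (0 < i)%N -> `|i%:R * t - 1| <= t / 2 -> exists (m : int) (n : nat),
  [/\ (0 < n)%N, 0 < `|m%:~R + n%:R * x| < 1 & `|m%:~R + n%:R * x| * (2 ^ k.+1)%:R <= 1].
  move=> i0 le; have [E N] := step i i0; exists (m *+ i - s), (i * n)%N.
  rewrite -E normr_gt0 N muln_gt0 i0 n0; split=> //=; first by lra.
  rewrite expnS natrM mulrA; apply: le_trans yk; apply: ler_wpM2r => //; lra.
case: (lerP (1 - j%:R * t) (t / 2)) => h.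
  by apply: (yk2 j) => //; rewrite ler0_norm; lra.
apply: (yk2 j.+1) => //; rewrite ger0_norm; last by lra.
have jE : j.+1%:R = j%:R + 1 :> R by rewrite natr1.
by rewrite jE; lra.
Qed.

Lemma kronecker (a b : R) : a < b -> exists (m : int) (n : nat), a < m%:~R + n%:R * x < b.
Proof.
move=> ab; have [k kP] : exists k, 1 < (2 ^ k)%:R * (b - a).
  have ba : 0 < b - a by lra.
  exists (Num.trunc (b - a)^-1).+1; rewrite -ltr_pdivrMr // mul1r.
  by apply: lt_trans (truncnS_gt _) _; rewrite ltr_nat; apply: ltn_expl.
have [m [n [n0 /andP[y0 y1] yk]]] := small_comb k.
set y := m%:~R + n%:R * x in y0 y1 yk.
have yba : `|y| < b - a.
  have k0 : 0 < (2 ^ k)%:R :> R by rewrite ltr0n expn_gt0.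
  by rewrite -(ltr_pM2r k0) [ltRHS]mulrC; apply: le_lt_trans yk kP.
have comb (m' : int) (j : nat) :
    m'%:~R + j%:R * y = (m' + m *+ j)%:~R + (j * n)%:R * x.
  by rewrite rmorphD /= rmorphMn /= natrM /y -mulr_natl; ring.
have [yP|yN] := lerP 0 y.
  rewrite ger0_norm // in y0 yba.
  have ge0 : 0 <= (a - (Num.floor a)%:~R) / y by apply: divr_ge0 => //; have := floor_le a; lra.
  have /andP[] := truncn_itv ge0; set j := Num.trunc _.
  rewrite ler_pdivlMr // ltr_pdivrMr // => h1 h2.
  exists (Num.floor a + m *+ j.+1), (j.+1 * n)%N; rewrite -comb.
  have jE : j.+1%:R = j%:R + 1 :> R by rewrite natr1.
by move: h2; rewrite jE; lra.
rewrite ltr0_norm // in y0 yba.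
have ge0 : 0 <= ((Num.floor b + 1)%:~R - b) / (- y).
  apply: divr_ge0; last by lra.
  by have := floor_itv b => /andP[_]; lra.
have /andP[] := truncn_itv ge0; set j := Num.trunc _.
rewrite ler_pdivlMr // ltr_pdivrMr // => h1 h2.
exists (Num.floor b + 1 + m *+ j.+1), (j.+1 * n)%N; rewrite -comb.
have jE : j.+1%:R = j%:R + 1 :> R by rewrite natr1.
by move: h2; rewrite jE; lra.
Qed.

End Kronecker.

Lemma irrationalN (R : realType) (x : R) : irrational x -> irrational (- x)%R.
Proof.
move=> h /rationalP[a [b E]]; apply: h; apply/rationalP; exists (- a)%R, b.
by rewrite rmorphN /= mulNr -E opprK.
Qed.


(** * Itineraries of a three interval exchange *)

Definition split_b (v w : seq abc) :=
  exists w1 w2, v = w1 ++ [:: A; C] ++ w2 /\ w = w1 ++ [:: B] ++ w2.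

Definition split_d (v w : seq abc) :=
  exists w1 w2, v = w1 ++ [:: B] ++ w2 /\ w = w1 ++ [:: C; A] ++ w2.

Lemma split_b_cons a v w : split_b v w -> split_b (a :: v) (a :: w).
Proof. by move=> [w1 [w2 [-> ->]]]; exists (a :: w1), w2. Qed.

Lemma split_d_cons a v w : split_d v w -> split_d (a :: v) (a :: w).
Proof. by move=> [w1 [w2 [-> ->]]]; exists (a :: w1), w2. Qed.

Definition iet_params (R : realType) (e l : R) :=
  [/\ 0 < e < 1, irrational e & Num.max e (1 - e) < l < 1]%R.

(** The form in which non-degeneracy is used. *)
Definition apart (R : realType) (e l c : R) := forall k,
  iter k (iet_map e l c) (c + l - 1 + e)%R <> (c + e)%R /\
  iter k (iet_map e l c) (c + e)%R <> (c + l - 1 + e)%R.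

Section Exchange.
Local Open Scope ring_scope.
Variables (R : realType) (e l c : R).
Hypothesis eP : iet_params e l.

Let e01 : 0 < e < 1. Proof. by case: eP. Qed.
Let e_irr : irrational e. Proof. by case: eP. Qed.

Local Notation T := (iet_map e l c).
Local Notation b := (c + l - 1 + e).
Local Notation d := (c + e).
Local Notation inI x := (c <= x < c + l).

Definition letter (x : R) : abc := if x < b then A else if x < d then B else C.

Definition itinerary (x : R) (n : nat) : seq abc :=
  mkseq (fun k => letter (iter k T x)) n.

Definition translation (a : abc) : R :=
  match a with A => 1 - e | B => 1 - 2 * e | C => - e end.

Definition weight (f : abc -> R) (w : seq abc) : R := \sum_(a <- w) f a.

Lemma weight_cat f w w' : weight f (w ++ w') = weight f w + weight f w'.
Proof. by rewrite /weight big_cat. Qed.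

Lemma weight_cons f a w : weight f (a :: w) = f a + weight f w.
Proof. by rewrite /weight big_cons. Qed.

Lemma weight_nil f : weight f [::] = 0.
Proof. by rewrite /weight big_nil. Qed.

Lemma param_bounds : [/\ e < l, 1 - e < l & l < 1].
Proof. by case: eP => _ _; rewrite gt_max => /andP[/andP[]]. Qed.

Lemma pieceP x : [\/ [/\ x < b, letter x = A & T x = x + 1 - e],
  [/\ b <= x, x < d, letter x = B & T x = x + 1 - 2 * e] |
  [/\ d <= x, letter x = C & T x = x - e]].
Proof.
have [? ? ?] := param_bounds; rewrite /letter /iet_map.
case: ltP => h1; first by constructor 1.
by case: ltP => h2; [constructor 2|constructor 3].
Qed.

Lemma T_translation x : T x = x + translation (letter x).
Proof. by case: (pieceP x) => [[_ -> ->]|[_ _ -> ->]|[_ -> ->]] /=; ring. Qed.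

Lemma T_inI x : inI x -> inI (T x).
Proof.
have [? ? ?] := param_bounds; have /andP[? ?] := e01 => /andP[? ?].
by case: (pieceP x) => [[? _ ->]|[? ? _ ->]|[? _ ->]]; lra.
Qed.

Lemma T_inj x y : inI x -> inI y -> T x = T y -> x = y.
Proof.
have [? ? ?] := param_bounds; have /andP[? ?] := e01 => /andP[? ?] /andP[? ?].
by case: (pieceP x) => [[? _ ->]|[? ? _ ->]|[? _ ->]];
   case: (pieceP y) => [[? _ ->]|[? ? _ ->]|[? _ ->]]; lra.
Qed.

Lemma iterT_inI n x : inI x -> inI (iter n T x).
Proof. by move=> xI; elim: n => //= n; apply: T_inI. Qed.

Lemma iterT_inj n x y : inI x -> inI y -> iter n T x = iter n T y -> x = y.
Proof.
move=> xI yI; elim: n => //= n IH /T_inj h; apply: IH.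
by apply: h; apply: iterT_inI.
Qed.

Lemma itineraryS x n : itinerary x n.+1 = letter x :: itinerary (T x) n.
Proof.
rewrite /itinerary mkseq_cons; congr cons; apply: eq_mkseq => k.
by rewrite iterSr.
Qed.

Lemma itineraryD x n m : itinerary x (n + m) = itinerary x n ++ itinerary (iter n T x) m.
Proof.
rewrite /itinerary mkseqD; congr cat; apply: eq_mkseq => k.
by rewrite addnC iterD.
Qed.

Lemma size_itinerary x n : size (itinerary x n) = n.
Proof. exact: size_mkseq. Qed.

Lemma iterT_weight x n : iter n T x = x + weight translation (itinerary x n).
Proof.
elim: n x => [|n IH] x; first by rewrite weight_nil addr0.
by rewrite itineraryS weight_cons iterSr IH T_translation addrA.
Qed.

Lemma translation_counts w : weight translation w =
  (count_mem false (mext sigma01 w))%:R - e * (size (mext sigma01 w))%:R.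
Proof.
elim: w => [|a w IH]; first by rewrite weight_nil /= mulr0 subr0.
rewrite weight_cons IH mext_cons count_cat size_cat !natrD.
by case: a => /=; ring.
Qed.

Lemma translation_size w w' : weight translation w = weight translation w' ->
  size (mext sigma01 w) = size (mext sigma01 w').
Proof.
rewrite !translation_counts; set n := size _; set n' := size _.
set k := count _ _; set k' := count _ _.
have key (i i' j j' : nat) : i%:R - e * j%:R = i'%:R - e * j'%:R -> ~ (j < j')%N.
  move=> E jj; have : (i'%:Z - i%:Z)%:~R + (j' - j)%:R * (- e) != 0.
    by apply: irrational_comb; [apply: irrationalN|lia].
  rewrite intrD rmorphN /= natrB; last exact: ltnW.
  by move/eqP; apply; rewrite -!pmulrn; lra.
move=> E; have := key _ _ _ _ E; have := key _ _ _ _ (esym E); lia.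
Qed.

Lemma sigma01_nonerasing : nonerasing sigma01.
Proof. by case. Qed.

Lemma translation_eq0 w : weight translation w = 0 -> w = [::].
Proof.
rewrite -(weight_nil translation) => /translation_size /= E; apply/size0nil/eqP.
by rewrite -leqn0 -E; apply: size_mext sigma01_nonerasing.
Qed.

Lemma iterT_aperiodic n x : iter n.+1 T x <> x.
Proof.
move=> E; have := iterT_weight x n.+1; rewrite E => h.
have /translation_eq0 : weight translation (itinerary x n.+1) = 0 by lra.
by rewrite itineraryS.
Qed.

(** The exchange is the first return to [I] of a rotation by [- e] of the
    circle of length [1]; a point [B] goes through the part of the circle outside [I]. *)
Lemma same_orbit (n : nat) (p z : R) (m : int) : inI p -> inI z ->
  z = p + m%:~R - n%:R * e -> exists k, iter k T p = z.
Proof.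
have [? ? l1] := param_bounds; have /andP[e0 e1] := e01.
have int0 (i : int) (y : R) : -1 < y -> y < 1 -> y = i%:~R -> i = 0.
  move=> y1 y2 E; move: y1 y2; rewrite E => h1 h2.
  have : -1 < i by rewrite -(ltr_int R) rmorphN1.
  by have : i < 1 by [rewrite -(ltr_int R)]; lia.
move=> + zI; have [N] := ubnP n.
elim: N n p m => // N IH [|n] p m; rewrite ltnS => nN pI zE.
  rewrite mul0r subr0 in zE; exists 0%N; have m0 : m = 0 by apply: (@int0 m (z - p)); lra.
  by rewrite zE m0 addr0.
have nE : n.+1%:R = n%:R + 1 :> R by rewrite natr1.
rewrite nE in zE; have TI := T_inI pI.
have next k q : iter k T (T p) = q -> exists k, iter k T p = q.
  by move=> E; exists k.+1; rewrite iterSr.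
case: (pieceP p) => [[_ _ E]|[p1 p2 _ E]|[_ _ E]].
- have [|k kz] := IH n _ (m - 1) nN TI; last exact: next kz.
  by rewrite E zE rmorphB /=; lra.
- case: n nN zE nE => [|n] nN zE nE.
    have [m0|[m1|m2]] : m <= 0 \/ m = 1 \/ 2 <= m by clear; lia.
    + have : m%:~R <= 0 :> R by rewrite lerz0.
      by move: zI; rewrite zE; lra.
    + by move: zI; rewrite zE m1; lra.
    + have : 2 <= m%:~R :> R by rewrite (ler_int R 2).
      by move: zI; rewrite zE; lra.
  have [|k kz] := IH n _ (m - 1) (ltnW nN) TI; last exact: next kz.
  have nE2 : n.+1%:R = n%:R + 1 :> R by rewrite natr1.
  by rewrite E zE nE2 rmorphB /=; lra.
- have [|k kz] := IH n _ m nN TI; last exact: next kz.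
  by rewrite E zE; lra.
Qed.

Lemma forward_dense q x y : inI q -> c <= x -> x < y -> y <= c + l ->
  exists k, x < iter k T q < y.
Proof.
move=> qI cx xy yl; have xyq : x - q < y - q by lra.
have [m [n mn]] := kronecker (irrationalN e_irr) xyq.
have zI : inI (q + m%:~R - n%:R * e) by lra.
have [k kE] := same_orbit qI zI (erefl _).
by exists k; rewrite kE; lra.
Qed.

Lemma backward_dense q x y : inI q -> c <= x -> x < y -> y <= c + l ->
  exists k z, x < z < y /\ iter k T z = q.
Proof.
move=> qI cx xy yl; have xyq : x - q < y - q by lra.
have [m [n mn]] := kronecker e_irr xyq.
pose z := q + m%:~R + n%:R * e.
have zI : inI z by rewrite /z; lra.
have [|k kE] := @same_orbit n _ _ (- m) zI qI; first by rewrite rmorphN /= /z; lra.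
by exists k, z; split => //; rewrite /z; lra.
Qed.

(** * Two neighbouring points *)

Definition is_cut x := x = b \/ x = d.

Lemma step_same x y : inI x -> inI y -> x < y ->
  (forall z, x < z <= y -> ~ is_cut z) ->
  [/\ letter x = letter y, T y = T x + (y - x) &
    forall z, T x < z <= T y -> x < z - T x + x <= y /\ T (z - T x + x) = z].
Proof.
move=> xI yI xy nocut; have [? ? ?] := param_bounds.
have nb z : x < z <= y -> (x < b) = (z < b) /\ (x < d) = (z < d).
  move=> zxy; have hb : ~ (x < b <= y) by move/nocut; apply; left.
  have hd : ~ (x < d <= y) by move/nocut; apply; right.
  by split; apply/idP/idP => h; lra.
have TE z : x < z <= y -> letter x = letter z /\ T z = T x + (z - x).
  move=> /nb[E1 E2]; have L : letter x = letter z by rewrite /letter E1 E2.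
  by split=> //; rewrite !T_translation L; lra.
have yy : x < y <= y by rewrite xy lexx.
have [Ly Ty] := TE y yy; split=> // z; rewrite Ty => zT.
have zxy : x < z - T x + x <= y by lra.
by split=> //; have [_ ->] := TE _ zxy; lra.
Qed.

(** An interval which contains no discontinuity is translated as a whole. *)
Lemma parallel N x y : inI x -> inI y -> x < y ->
  (forall z r, x < z <= y -> (r < N)%N -> ~ is_cut (iter r T z)) ->
  itinerary x N = itinerary y N /\ iter N T y = iter N T x + (y - x).
Proof.
elim: N x y => [|N IH] x y xI yI xy nocut; first by split=> //=; lra.
have [|L Ty sub] := step_same xI yI xy; first by move=> z zxy; apply: (nocut z 0%N).
have [||||I E] := IH (T x) (T y); try exact: T_inI.
- by rewrite Ty; lra.
- move=> z r /sub[zxy <-] rN; rewrite -iterSr; exact: nocut.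
by rewrite !itineraryS L I !iterSr E Ty; split=> //; lra.
Qed.

(** As [T] is injective, a discontinuity has at most one preimage of each order. *)
Lemma cuts_isolated p N : exists2 k : R, 0 < k & forall z r,
  inI z -> (r < N)%N -> z != p -> `|z - p| < k -> ~ is_cut (iter r T z).
Proof.
elim: N => [|N [k k0 IH]]; first by exists 1.
have one q : exists2 k : R, 0 < k & forall z,
    inI z -> z != p -> `|z - p| < k -> iter N T z <> q.
  case: (pselect (exists z, [/\ inI z, z != p & iter N T z = q])) => [[z [zI zp zq]]|none].
    exists `|z - p|; first by rewrite normr_gt0 subr_eq0.
    move=> z' zI' zp' lt E; have zz : z' = z by apply: (@iterT_inj N); rewrite ?E.
    by rewrite zz ltxx in lt.
  by exists 1 => // z zI zp _ E; apply: none; exists z.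
have [kb kb0 kbP] := one b; have [kd kd0 kdP] := one d.
exists (Num.min k (Num.min kb kd)); first by rewrite !lt_min k0 kb0 kd0.
move=> z r zI rN zp; rewrite !lt_min => /and3P[zk zb zd].
have [rN'|rN'] := ltnP r N; first exact: IH.
have -> : r = N by apply/eqP; rewrite eqn_leq -ltnS rN.
by move=> [|]; [apply: kbP|apply: kdP].
Qed.

(** At a distance less than [gap] of a discontinuity one reads [AC] or [B] at [b], and [B] or
    [CA] at [d], according to the side. *)
Definition gap := Num.min (l - e) (Num.min (l - 1 + e) (1 - l)).

Lemma gap_gt0 : 0 < gap.
Proof. by have [? ? ?] := param_bounds; rewrite /gap !lt_min; lra. Qed.

Hypothesis b_d_apart : apart e l c.

Lemma cut_once q r : is_cut q -> ~ is_cut (iter r.+1 T q).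
Proof.
move=> [] -> [] E.
- exact: iterT_aperiodic E.
- exact: (b_d_apart r.+1).1.
- exact: (b_d_apart r.+1).2.
- exact: iterT_aperiodic E.
Qed.

Lemma b_inI : inI b.
Proof. by have [? ? ?] := param_bounds; have /andP[? ?] := e01; lra. Qed.

Lemma d_inI : inI d.
Proof. by have [? ? ?] := param_bounds; have /andP[? ?] := e01; lra. Qed.

(** Two points separated by [b] are neighbours again, on the two sides of [T b], as soon as
    the left one has read [AC] and the right one [B]; then nothing separates them
    any more, because the orbit of [b] meets no other discontinuity. *)
Lemma step_b x y N : inI x -> inI y -> x < b <= y -> y - x < gap ->
  (forall z r, x < z <= y -> z != b -> (r < N.+2)%N -> ~ is_cut (iter r T z)) ->
  [/\ [/\ letter x = A, letter (T x) = C & letter y = B],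
      T b = T (T x) + (b - x), T y = T (T x) + (y - x) &
      forall z r, T (T x) < z <= T y -> (r < N)%N -> ~ is_cut (iter r T z)].
Proof.
move=> xI yI xby; rewrite /gap !lt_min => /and3P[g1 g2 g3] iso.
have [? ? ?] := param_bounds; have /andP[? ?] := e01.
have [Lx Tx] : letter x = A /\ T x = x + 1 - e by case: (pieceP x) => -[]; try lra.
have [Lx' Tx'] : letter (T x) = C /\ T (T x) = T x - e by case: (pieceP (T x)) => -[]; try lra.
have [Ly Ty] : letter y = B /\ T y = y + 1 - 2 * e by case: (pieceP y) => -[]; try lra.
have Tb : T b = b + 1 - 2 * e by case: (pieceP b) => -[]; try lra.
split=> //; try lra.
move=> z r zxy rN; have [zb|bz] := ltP z (T b).
  have E : z = iter 2 T (z - 1 + 2 * e).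
    have E1 : T (z - 1 + 2 * e) = z + e by case: (pieceP (z - 1 + 2 * e)) => -[]; try lra.
    by rewrite /= E1; case: (pieceP (z + e)) => -[]; try lra.
  rewrite E -iterD; apply: iso; [lra| |by rewrite addn2].
  by rewrite lt_eqF //; lra.
have E : z = T (z - 1 + 2 * e) by case: (pieceP (z - 1 + 2 * e)) => -[]; try lra.
have [zE|zb] := eqVneq (z - 1 + 2 * e) b.
  by rewrite E zE -iterSr; apply: cut_once; left.
by rewrite E -iterSr; apply: iso => //; [lra|exact: ltnW].
Qed.

(** The same at [d], where the left point reads [B] and the right one [CA]. *)
Lemma step_d x y N : inI x -> inI y -> x < d <= y -> y - x < gap ->
  (forall z r, x < z <= y -> z != d -> (r < N.+2)%N -> ~ is_cut (iter r T z)) ->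
  [/\ [/\ letter x = B, letter y = C & letter (T y) = A],
      T x < T (T y), T (T y) = T x + (y - x) &
      forall z r, T x < z <= T (T y) -> (r < N)%N -> ~ is_cut (iter r T z)].
Proof.
move=> xI yI xdy; rewrite /gap !lt_min => /and3P[g1 g2 g3] iso.
have [? ? ?] := param_bounds; have /andP[? ?] := e01.
have [Lx Tx] : letter x = B /\ T x = x + 1 - 2 * e by case: (pieceP x) => -[]; try lra.
have [Ly Ty] : letter y = C /\ T y = y - e by case: (pieceP y) => -[]; try lra.
have [Ly' Ty'] : letter (T y) = A /\ T (T y) = T y + 1 - e by case: (pieceP (T y)) => -[]; try lra.
split=> //; try lra.
move=> z r zxy rN; have [zd|dz] := ltP z (d + 1 - 2 * e).
  have E : z = T (z - 1 + 2 * e) by case: (pieceP (z - 1 + 2 * e)) => -[]; try lra.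
  rewrite E -iterSr; apply: iso; [lra| |exact: ltnW].
  by rewrite lt_eqF //; lra.
have E : z = iter 2 T (z - 1 + 2 * e).
  have E1 : T (z - 1 + 2 * e) = z - 1 + e by case: (pieceP (z - 1 + 2 * e)) => -[]; try lra.
  by rewrite /= E1; case: (pieceP (z - 1 + e)) => -[]; try lra.
rewrite E -iterD; have [zE|zb] := eqVneq (z - 1 + 2 * e) d.
  by rewrite zE addnS; apply: cut_once; right.
by apply: iso => //; [lra|rewrite addn2].
Qed.

Lemma itinerary_prefix x n m : (n <= m)%N -> itinerary x n = take n (itinerary x m).
Proof.
by move=> nm; rewrite -(subnKC nm) itineraryD take_size_cat // size_itinerary.
Qed.

(** Only the empty word has weight [0], the number [e] being irrational. *)
Lemma same_weight_eq v w x y N : (size v <= N)%N -> (size w <= N)%N ->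
  v = itinerary x (size v) -> w = itinerary y (size w) ->
  itinerary x N = itinerary y N -> weight translation v = weight translation w -> v = w.
Proof.
move=> vN wN vE wE xy.
have {}vE : v = take (size v) (itinerary y N) by rewrite -xy -itinerary_prefix.
have {}wE : w = take (size w) (itinerary y N) by rewrite -itinerary_prefix.
wlog le : v w vN wN vE wE / (size v <= size w)%N.
  by move=> H; case: (leqP (size v) (size w)) => [|/ltnW] h E; [apply: H|apply/esym/H].
move=> E; have wE2 : w = v ++ drop (size v) w.
  by rewrite -[LHS](cat_take_drop (size v)); congr cat; rewrite [RHS]vE {1}wE take_takel.
have : weight translation (drop (size v) w) = 0.
  by move: E; rewrite {1}wE2 weight_cat; lra.
by move=> /translation_eq0 w0; rewrite wE2 w0 cats0.
Qed.

(** The orbit of [p] meets a discontinuity at most once, and only there can the words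
    read on its two sides begin to differ; the weights being equal, both words end
    before or after the two steps of the separation. *)
Lemma read_around N v w x p y : inI x -> inI y -> x < p <= y -> y - x < gap ->
  (forall z r, x < z <= y -> z != p -> (r < N)%N -> ~ is_cut (iter r T z)) ->
  (size v < N)%N -> (size w < N)%N ->
  v = itinerary x (size v) -> w = itinerary y (size w) ->
  weight translation v = weight translation w ->
  [\/ v = w, split_b v w | split_d v w].
Proof.
elim: N v w x p y => // N IH [|a v] [|a' w] x p y xI yI xpy yx iso.
- by constructor 1.
- by rewrite weight_nil => _ _ _ _ /esym/translation_eq0.
- by rewrite weight_nil => _ _ _ _ /translation_eq0.
rewrite /= !ltnS => vN wN; rewrite !itineraryS => -[aE vE] [aE' wE] W.
have := W; rewrite !weight_cons => E.
case: (pselect (is_cut p)) => [[pb|pd]|pN].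
- rewrite {p}pb in xpy iso.
  case: N {IH} vN wN iso => // N vN wN iso.
  have [[Lx Lx' Ly] Txy Ty nocut] := step_b xI yI xpy yx iso.
  rewrite aE aE' Lx Ly in E *.
  case: v vN vE E W => [|a2 v] vN; first by rewrite aE aE' Lx Ly => _ _ /translation_size.
  rewrite /= itineraryS weight_cons => -[-> vE] E _; rewrite Lx' /= in E *.
  have [||||I _] := @parallel N (T (T x)) (T y); rewrite ?T_inI //; first lra.
  have -> : v = w.
    by apply: (@same_weight_eq v w (T (T x)) (T y) N) => //; [exact: ltnW|lra].
  by constructor 2; exists [::], w.
- rewrite {p}pd in xpy iso.
  case: N {IH} vN wN iso => // N vN wN iso.
  have [[Lx Ly Ly'] Txy Ty nocut] := step_d xI yI xpy yx iso.
  rewrite aE aE' Lx Ly in E *.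
  case: w wN wE E W => [|a2 w] wN; first by rewrite aE aE' Lx Ly => _ _ /translation_size.
  rewrite /= itineraryS weight_cons => -[-> wE] E _; rewrite Ly' /= in E *.
  have [||||I _] := @parallel N (T x) (T (T y)); rewrite ?T_inI //.
  have -> : v = w.
    by apply: (@same_weight_eq v w (T x) (T (T y)) N) => //; [exact: ltnW|lra].
  by constructor 3; exists [::], w.
have N0 := leq_ltn_trans (leq0n _) vN.
have nocut z : x < z <= y -> ~ is_cut z.
  by move=> zxy; have [->//|zp] := eqVneq z p; apply: (iso z 0%N).
have xy : x < y by lra.
have [L Ty sub] := step_same xI yI xy nocut.
have pxy : x < p <= y by [].
have Tp : T p = T x + (p - x).
  have h : T x < p - x + T x <= T y by lra.
  have [_] := sub _ h; have -> : p - x + T x - T x + x = p by ring.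
  by move=> ->; ring.
rewrite aE aE' L in E *.
have isoT z r : T x < z <= T y -> z != T p -> (r < N)%N -> ~ is_cut (iter r T z).
  move=> /sub[zxy zE] zp rN; rewrite -zE -iterSr; apply: iso => //.
  by apply: contraNneq zp => zp; rewrite -zE zp.
have TT : T x < T p <= T y by lra.
have Tgap : T y - T x < gap by lra.
have vw : weight translation v = weight translation w by lra.
have := IH v w _ _ _ (T_inI xI) (T_inI yI) TT Tgap isoT vN wN vE wE vw.
case=> [->|/(split_b_cons (letter y)) h|/(split_d_cons (letter y)) h].
- by constructor 1.
- by constructor 2.
- by constructor 3.
Qed.
End Exchange.


(** * Bounded Birkhoff sums *)

Section BoundedSums.
Local Open Scope ring_scope.
Variables (R : realType) (e l c : R).
Hypothesis eP : iet_params e l.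
Hypothesis b_d_apart : apart e l c.
Hypothesis c0 : c <= 0 < c + l.

Local Notation T := (iet_map e l c).
Local Notation b := (c + l - 1 + e).
Local Notation d := (c + e).
Local Notation inI x := (c <= x < c + l).
Local Notation itin := (itinerary e l c).
Local Notation is_cut := (is_cut e l c).

Lemma pass_b k j x z y : inI x -> inI y -> x < z < y -> y - x < gap e l -> iter k T z = b ->
  (forall z' r, x < z' <= y -> z' != z -> (r < k + j.+2)%N -> ~ is_cut (iter r T z')) ->
  exists w1 w2, [/\ itin x (k + j.+2) = w1 ++ [:: A; C] ++ w2,
    itin y (k + j.+1) = w1 ++ [:: B] ++ w2,
    iter (k + j.+2) T x = iter j T (T b) - (z - x) &
    iter (k + j.+1) T y = iter j T (T b) + (y - z)].
Proof.
move=> xI yI xzy yx zb iso.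
have zI : inI z by lra.
have nocut z' r : x < z' <= y -> (r < k)%N -> ~ is_cut (iter r T z').
  move=> z'xy rk; have [->|z'z] := eqVneq z' z; last first.
    by apply: iso => //; apply: ltn_addr.
  move=> /cut_once-/(_ eP b_d_apart (k - r.+1)%N); rewrite -iterD; apply.
  have -> : ((k - r.+1).+1 + r)%N = k by rewrite addSnnS subnK.
  by rewrite zb; left.
have par z' : x < z' <= y -> itin x k = itin z' k /\ iter k T z' = iter k T x + (z' - x).
  move=> z'xy; apply: parallel => //; [lra|lra|].
  by move=> t r txz'; apply: nocut; lra.
have [|xyw yk] := par y; first lra.
have [|_] := par z; first lra.
rewrite zb => zk.
have iso' z' r : iter k T x < z' <= iter k T y -> z' != b -> (r < j.+2)%N -> ~ is_cut (iter r T z').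
  move=> z'k z'b rj; pose t := z' - iter k T x + x.
  have txy : x < t <= y by rewrite /t; lra.
  have [_ tk] := par t txy.
  have -> : z' = iter k T t by rewrite tk /t; lra.
  rewrite -iterD; apply: iso => //; last by rewrite addnC ltn_add2l.
  by apply: contraNneq z'b => tz; rewrite zk -tz /t; lra.
have kxy : iter k T x < b <= iter k T y by lra.
have kgap : iter k T y - iter k T x < gap e l by lra.
have xkI := iterT_inI eP k xI; have ykI := iterT_inI eP k yI.
have [[Lx Lx' Ly] Txy Ty nocut'] := step_b eP b_d_apart xkI ykI kxy kgap iso'.
have TxI := T_inI eP (T_inI eP xkI); have TyI := T_inI eP ykI.
have TbI := T_inI eP (b_inI c eP).
have [|w2E Tj] := parallel eP TxI TyI _ nocut'; first by lra.
have [||_ Tb] := @parallel _ _ _ _ eP j _ _ TxI TbI; first by lra.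
  by move=> t r tx; apply: nocut'; lra.
exists (itin x k), (itin (T (iter k T y)) j); split.
- by rewrite itineraryD !itineraryS Lx Lx' w2E.
- by rewrite itineraryD itineraryS Ly xyw.
- rewrite addnC iterD !iterSr Tb; have := Tb; lra.
- rewrite addnC iterD !iterSr Tj Tb; lra.
Qed.

Variable f : abc -> R.
Local Notation h n := (weight f (itin 0 n)).
Variable M : R.
Hypothesis h_bounded : forall n, `|h n| <= M.

Lemma sumsD n k : h (n + k) = h n + weight f (itin (iter n T 0) k).
Proof. by rewrite itineraryD weight_cat. Qed.

(** Between a time at which the sum is nearly minimal and one at which it is nearly
    maximal one reads a word of nearly maximal or minimal sum; at each occurrence of
    this word the sum has to be nearly the same. *)
Lemma nearly_constant (t : R) : 0 < t -> exists x y, [/\ c <= x, x < y, y <= c + l &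
  forall i j, x < iter i T 0 < y -> x < iter j T 0 < y -> h i - h j <= t].
Proof.
move=> t0; pose E := [set r | exists n, r = h n]%classic.
have E0 : (E !=set0)%classic by exists (h 0); exists 0%N.
have Eub : has_ubound E.
  by exists M => _ [n ->]; apply: le_trans (h_bounded n); apply: ler_norm.
have Elb : has_lbound E.
  exists (- M) => _ [n ->]; rewrite lerNl; apply: le_trans (h_bounded n).
  by rewrite -normrN; apply: ler_norm.
have t2 : 0 < t / 2 by lra.
have [_ [m ->] mP] := sup_adherent t2 (conj E0 Eub).
have [_ [n ->] nQ] := inf_adherent t2 (conj E0 Elb).
have leP i : h i <= sup E by apply: ub_le_sup => //; exists i.
have geQ i : inf E <= h i by apply: ge_inf => //; exists i.
have I0 k : inI (iter k T 0) by apply: iterT_inI.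
have occ i0 k : exists y, [/\ iter i0 T 0 < y, y <= c + l & forall i,
    iter i0 T 0 < iter i T 0 < y -> h (i + k) = h i + (h (i0 + k) - h i0)].
  have [k' k'0 iso] := cuts_isolated c eP (iter i0 T 0) k.
  have /andP[z1 z2] := I0 i0.
  exists (Num.min (iter i0 T 0 + k') (c + l)); split.
  - by rewrite lt_min; apply/andP; split => //; lra.
  - by rewrite ge_min lexx orbT.
  move=> i; rewrite lt_min => /and3P[i1 i2 i3]; rewrite !sumsD.
  have [|<- _] := @parallel _ _ _ _ eP k _ _ (I0 i0) (I0 i) i1; last by lra.
  move=> z r zi rk; apply: iso => //; first by have := I0 i; lra.
    by rewrite gt_eqF //; lra.
  by rewrite gtr0_norm; lra.
have [nm|mn] := leqP n m.
- have [y [y1 y2 yP]] := occ n (m - n)%N.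
  exists (iter n T 0), y; split=> //; first by case/andP: (I0 n).
  move=> i j /yP hi /yP hj; rewrite subnKC // in hi hj.
  have := leP (i + (m - n))%N; have := geQ j; rewrite hi; lra.
- have [y [y1 y2 yP]] := occ m (n - m)%N.
  exists (iter m T 0), y; split=> //; first by case/andP: (I0 m).
  move=> i j /yP hi /yP hj; rewrite subnKC ?(ltnW mn) // in hi hj.
  have := geQ (j + (n - m))%N; have := leP i; rewrite hj; lra.
Qed.

(** Take two points on the two sides of some [z] whose orbit meets [b], with [z] in an
    interval on which the sums are nearly constant, and follow their orbits until they
    are in this interval again. The increments of the sums are nearly zero, but they
    differ by [f A + f C - f B]. *)
Lemma bounded_sums_additive : f B = f A + f C.
Proof.
apply: contrapT => /eqP fN; pose t := `|f B - (f A + f C)| / 3.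
have t0 : 0 < t by rewrite divr_gt0 // normr_gt0 subr_eq0.
have [x [y [cx xy yl hP]]] := nearly_constant t0.
have [k [z [zxy zb]]] := backward_dense eP (b_inI c eP) cx xy yl.
have [j jxy] := forward_dense eP (T_inI eP (b_inI c eP)) cx xy yl.
have [g g0 iso] := cuts_isolated c eP z (k + j.+2)%N.
set z' := iter j T (T b) in jxy *.
have gap0 : 0 < gap e l / 2 by have := gap_gt0 eP; lra.
pose q := Num.min g (Num.min (gap e l / 2) (Num.min (Num.min (z - x) (y - z))
  (Num.min (z' - x) (y - z')))).
have q0 : 0 < q by rewrite !lt_min g0 gap0 /=; lra.
have : q <= q by []; rewrite {2}/q !le_min => /and5P[qg qgap /andP[q1 q2] q3 q4].
have [i iz] : exists i, z - q < iter i T 0 < z by apply: forward_dense => //; lra.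
have [i' iz'] : exists i, z < iter i T 0 < z + q by apply: forward_dense => //; lra.
have I0 n : inI (iter n T 0) by apply: iterT_inI.
have iso' t' r : iter i T 0 < t' <= iter i' T 0 -> t' != z -> (r < k + j.+2)%N -> ~ is_cut (iter r T t').
  move=> t'i t'z rk; apply: iso => //; first by have := I0 i; have := I0 i'; lra.
  by rewrite ltr_norml; lra.
have [||w1 [w2 [xw yw xz yz]]] := pass_b (I0 i) (I0 i') _ _ zb iso'; [lra|lra|].
have h1 : h (i + (k + j.+2)) = h i + (weight f w1 + (f A + f C) + weight f w2).
  by rewrite sumsD xw !weight_cat !weight_cons weight_nil; ring.
have h2 : h (i' + (k + j.+1)) = h i' + (weight f w1 + f B + weight f w2).
  by rewrite sumsD yw !weight_cat !weight_cons weight_nil; ring.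
rewrite -!iterD ![(_ + i)%N]addnC ![(_ + i')%N]addnC in xz yz.
have i1 : x < iter i T 0 < y by lra.
have i2 : x < iter i' T 0 < y by lra.
have i3 : x < iter (i + (k + j.+2)) T 0 < y by rewrite xz -/z'; lra.
have i4 : x < iter (i' + (k + j.+1)) T 0 < y by rewrite yz -/z'; lra.
have := hP _ _ i1 i2; have := hP _ _ i2 i1; have := hP _ _ i3 i4; have := hP _ _ i4 i3.
rewrite h1 h2 => a1 a2 a3 a4.
have : `|f B - (f A + f C)| <= 2 * t by rewrite ler_norml; lra.
by move: t0; rewrite /t; lra.
Qed.

(** For an additive [f] the sum after [n] steps is a combination of the point [T^n 0], which
    is bounded, and of the length of a word, which is not. *)
Lemma bounded_sums_proportional : exists k, forall a, f a = k * translation e a.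
Proof.
have fB := bounded_sums_additive; have [/andP[e0 e1] _ _] := eP.
have hE n : h n = (f A - f C) * iter n T 0 +
    ((f A - f C) * e + f C) * (size (mext sigma01 (itin 0 n)))%:R.
  rewrite iterT_weight // translation_counts add0r.
  elim: (itin 0 n) => [|a w IH]; first by rewrite weight_nil /= !mulr0 subr0; ring.
  rewrite weight_cons IH mext_cons count_cat size_cat !natrD.
  by case: a => /=; rewrite ?fB; ring.
set s := (f A - f C) * e + f C in hE.
have s0 : s = 0.
  apply: contrapT => /eqP sN.
  pose D := M + `|f A - f C|.
  have hD n : `|s| * n%:R <= D.
    have sn : n%:R <= (size (mext sigma01 (itin 0 n)))%:R :> R.
      by rewrite ler_nat -{1}(size_itinerary e l c 0 n) size_mext //; apply: sigma01_nonerasing.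
    have xn : `|iter n T 0| <= 1.
      have [_ _ l1] := param_bounds eP; have /andP[x1 x2] := iterT_inI eP n c0.
      by have /andP[c1 c2] := c0; rewrite ler_norml; lra.
    apply: le_trans (_ : `|s| * (size (mext sigma01 (itin 0 n)))%:R <= _); first exact: ler_wpM2l.
    rewrite -[X in _ * X]normr_nat -normrM.
    have -> : s * (size (mext sigma01 (itin 0 n)))%:R = h n - (f A - f C) * iter n T 0.
      by rewrite hE; ring.
    apply: le_trans (ler_normB _ _) _; apply: lerD => //.
    by rewrite normrM -[leRHS]mulr1 ler_wpM2l.
  have sp : 0 < `|s| by rewrite normr_gt0.
  have D0 : 0 <= D by have := hD 0%N; rewrite mulr0.
  have := truncnS_gt (D / `|s|); rewrite ltr_pdivrMr // mulrC => lt.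
  by have := lt_le_trans lt (hD _); rewrite ltxx.
exists (f A - f C) => -[] /=.
- by move: s0; rewrite /s; lra.
- by rewrite fB; move: s0; rewrite /s; lra.
- by move: s0; rewrite /s; lra.
Qed.

End BoundedSums.


(** * Non-degenerate three interval exchange words *)

Section IetWord.
Local Open Scope ring_scope.
Variables (R : realType) (e l c : R) (u : biword abc).
Hypothesis uP : is_3iet_word e l c u.

Local Notation T := (iet_map e l c).
Local Notation b := (c + l - 1 + e).
Local Notation d := (c + e).
Local Notation inI x := (c <= x < c + l).
Local Notation itin := (itinerary e l c).
Local Notation is_cut := (is_cut e l c).

Lemma word_params : iet_params e l.
Proof. by case: uP => -[]. Qed.

Lemma iet_domE x : iet_dom l c x = inI x.
Proof. by rewrite /iet_dom /= in_itv. Qed.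

Lemma word_inI0 : inI 0.
Proof. by case: uP => _ _; rewrite iet_domE. Qed.

Lemma iet_int_letter x : inI x -> iet_int e l c (letter e l c x) x.
Proof.
by case: (pieceP c word_params x) => [[? -> _]|[? ? -> _]|[? -> _]] /andP[? ?];
   rewrite /iet_int /= in_itv /=; apply/andP.
Qed.

Lemma word_letter n x : inI x -> iet_iter e l c n 0 x -> u n = letter e l c x.
Proof.
by move=> xI nx; case: uP => _ _ _ h; apply/h; exists x => //; apply: iet_int_letter.
Qed.

Lemma word_point n : exists2 x, inI x & iet_iter e l c n 0 x.
Proof.
case: n => [n|n]; first by exists (iter n T 0) => //; exact: (iterT_inI word_params n word_inI0).
case: uP => _ _ _ h; have [x nx _] := (h (Negz n) (u (Negz n))).1 erefl.
by exists x => //; case: nx; rewrite iet_domE.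
Qed.

Lemma iet_iterD n k x : iet_iter e l c n 0 x -> inI x -> iet_iter e l c (n + Posz k) 0 (iter k T x).
Proof.
case: n => [n|n] /= nx xI; first by rewrite nx addnC iterD.
have [_ nx0] := nx; have [kn|nk] := leqP k n.
  have -> : Negz n + Posz k = Negz (n - k) by clear -kn; lia.
  rewrite /= iet_domE; split; first exact: (iterT_inI word_params k xI).
  by rewrite -iterS -iterD addSn subnK.
have -> : Negz n + Posz k = Posz (k - n.+1) by clear -nk; lia.
by rewrite /= -{1}(subnK nk) iterD (nx0 : iter n.+1 T x = 0).
Qed.

Lemma word_right n : rhalf u n = letter e l c (iter n T 0).
Proof. by apply: word_letter => //; exact: (iterT_inI word_params n word_inI0). Qed.

Lemma word_rprefix n : rprefix (rhalf u) n = itin 0 n.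
Proof. by apply: eq_mkseq => k; apply: word_right. Qed.

Lemma word_factor w : bi_factor u w -> exists2 x, inI x & w = itin x (size w).
Proof.
move=> [n ->]; have [x xI nx] := word_point n; exists x => //.
rewrite size_mkseq; apply: eq_mkseq => k; apply: word_letter.
  exact: (iterT_inI word_params k xI).
exact: iet_iterD.
Qed.

(** If the orbit of [p] meets [q], then an itinerary of length [n] is determined by
    the place of its starting point with respect to the [n] first preimages of [p] and
    the [j] first preimages of [q]. *)
Lemma complexity_connected p q j : inI p ->
  (forall x, is_cut x -> x = p \/ x = q) -> iter j T p = q ->
  forall n, (complexity (bi_factor u) n <= (n + j).+1)%N.
Proof.
move=> pI cutE jpq n; have eP := word_params.
pose preim r x := xget 0 [set z | inI z /\ iter r T z = x]%classic.
have preimE r z : inI z -> preim r (iter r T z) = z.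
  move=> zI; have := @xgetPex _ 0 [set z' | inI z' /\ iter r T z' = iter r T z]%classic (ex_intro _ z (conj zI erefl)).
  by move=> [h1 h2]; apply: (iterT_inj eP h1 zI h2).
pose s := [seq preim r p | r <- iota 0 n] ++ [seq preim r q | r <- iota 0 j].
have sP z r : inI z -> (r < n)%N -> is_cut (iter r T z) -> z \in s.
  move=> zI rn /cutE[zp|zq]; rewrite mem_cat; apply/orP.
    by left; rewrite -(preimE r z zI) zp; apply: map_f; rewrite mem_iota.
  have [rj|jr] := ltnP r j.
    by right; rewrite -(preimE r z zI) zq; apply: map_f; rewrite mem_iota.
  left; have zp : iter (r - j) T z = p.
    apply: (@iterT_inj _ _ _ c eP j) => //; first exact: iterT_inI.
    by rewrite -iterD subnKC // zq.
  rewrite -(preimE (r - j)%N z zI) zp; apply: map_f; rewrite mem_iota.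
  exact: leq_ltn_trans (leq_subr _ _) rn.
pose rank (y : R) := count (fun z => z <= y) s.
have rankE x y : x < y -> rank y = (rank x + count (fun z => x < z <= y)%R s)%N.
  move=> xy; rewrite /rank; elim: (s) => //= z s' ->.
  have -> : (z <= y) = (z <= x) || (x < z <= y) :> bool.
    by case: (lerP z x) => h //=; rewrite (le_trans h (ltW xy)).
  rewrite ltNge; move: (z <= x) (z <= y) (count _ s') (count _ s') => p1 p2 m1 m2.
  by clear; case: p1; case: p2 => /=; lia.
have rank_itin x y : inI x -> inI y -> rank x = rank y -> itin x n = itin y n.
  wlog xy : x y / x < y.
    move=> H xI yI E; have [xy|yx|->//] := ltgtP x y; first exact: H.
    by apply/esym; apply: H.
  move=> xI yI E; apply: (parallel eP xI yI xy _).1 => z r zxy rn zcut.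
  have zs : z \in s by apply: (sP z r) => //; lra.
  have : has (fun z => x < z <= y) s by apply/hasP; exists z.
  by move: E; rewrite (rankE x y xy) has_count -[LHS]addn0 => /addnI<-.
have rank_le y : (rank y <= n + j)%N.
  by apply: leq_trans (count_size _ _) _; rewrite size_cat !size_map !size_iota.
pose pt (w : n.-tuple abc) := xget 0 [set y | inI y /\ tval w = itin y n]%classic.
pose g (w : n.-tuple abc) : 'I_(n + j).+1 := inord (rank (pt w)).
have ptP w : bi_factor u (tval w) -> inI (pt w) /\ tval w = itin (pt w) n.
  move=> /word_factor[x xI wE]; rewrite size_tuple in wE.
  exact: (@xgetPex _ 0 [set y | inI y /\ tval w = itin y n]%classic (ex_intro _ x (conj xI wE))).
rewrite /complexity -(card_ord (n + j).+1).
have gI : {in [pred w : n.-tuple abc | `[< bi_factor u (tval w) >]] &, injective g}.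
  move=> w w'; rewrite !inE => /ptP[I1 E1] /ptP[I2 E2] /(congr1 val).
  by rewrite /= !inordK ?ltnS // => /(rank_itin _ _ I1 I2) E; apply/val_inj; rewrite /= E1 E2.
by rewrite -(card_in_image gI); apply: max_card.
Qed.

Lemma nondegenerate_apart : nondegenerate_3iet u -> apart e l c.
Proof.
move=> nd k; have eP := word_params.
have no p q j : inI p -> (forall x, is_cut x -> x = p \/ x = q) -> iter j T p <> q.
  move=> pI cutE jpq; have := complexity_connected pI cutE jpq j.+1.
  by rewrite nd addSn addnn ltnn.
split; apply: no; [exact: b_inI|by []|exact: d_inI|].
by move=> x []; [right|left].
Qed.

End IetWord.


(** * The images of [AC], [B] and [CA] *)

Lemma primitive_nonerasing (X : finType) (f : wmorph X X) :
  primitive_morphism f -> nonerasing f.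
Proof.
move=> [[|k] // _ kP] a; apply/eqP => fa; have := kP (enum_rank a) (enum_rank a).
rewrite exprS mxE big1 // => j _; rewrite mxE enum_rankK fa /=; exact: mul0r.
Qed.

(** Commuting words are powers of the same word. *)
Lemma commute_weight (R : realType) (f : abc -> R) v w : v ++ w = w ++ v ->
  ((size w)%:R * weight f v = (size v)%:R * weight f w)%R.
Proof.
have [n] := ubnP (size v + size w); elim: n v w => // n IH v w.
wlog le : v w / size v <= size w.
  move=> H; case: (leqP (size v) (size w)) => [|/ltnW] h; first exact: H.
  by move=> lt E; apply/esym; apply: H => //; rewrite addnC.
have [-> _ _|vN lt E] := eqVneq v [::]; first by rewrite weight_nil mulr0 mul0r.
have wE : w = v ++ drop (size v) w.
  rewrite -[LHS](cat_take_drop (size v)); congr cat.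
  by have := congr1 (take (size v)) E; rewrite take_size_cat // takel_cat.
move: E lt; rewrite wE; move: (drop _ _) => {le wE}w.
rewrite -catA => /eqP; rewrite eqseq_cat // eqxx /= => /eqP E lt.
rewrite weight_cat size_cat natrD mulrDl mulrDr (IH _ _ _ E) //.
move: lt vN; rewrite -size_eq0 size_cat; move: (size v) (size w) => p q; clear; lia.
Qed.

Definition one_split (v w : seq abc) := [\/ v = w, split_b v w | split_d v w].

Section Images.
Local Open Scope ring_scope.
Variables (R : realType) (e l c : R) (u : biword abc) (eta : wmorph abc abc).
Hypothesis uP : is_3iet_word e l c u.
Hypothesis b_d_apart : apart e l c.
Hypothesis eta_nonerasing : nonerasing eta.
Hypothesis eta_fixes : r_image eta (rhalf u) (rhalf u).

Local Notation T := (iet_map e l c).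
Local Notation b := (c + l - 1 + e).
Local Notation d := (c + e).
Local Notation inI x := (c <= x < c + l).
Local Notation itin := (itinerary e l c).
Local Notation x_ n := (iter n T 0).
Local Notation wt := (weight (translation e)).

Let eP := word_params uP.
Let c0 := word_inI0 uP.

Lemma eta_itinerary n : mext eta (itin 0 n) = itin 0 (size (mext eta (itin 0 n))).
Proof. by have := eta_fixes.1 n; rewrite /= !(word_rprefix uP). Qed.

Lemma weight_eta w : weight (fun a => wt (eta a)) w = wt (mext eta w).
Proof.
by elim: w => [|a w IH]; rewrite ?weight_nil // weight_cons IH mext_cons weight_cat.
Qed.

Lemma eta_scales : exists2 k, k != 0 & forall w, wt (mext eta w) = k * wt w.
Proof.
have [n|k kP] := bounded_sums_proportional eP b_d_apart c0 (f := fun a => wt (eta a)) (M := 1).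
  rewrite weight_eta eta_itinerary; set m := size _.
  have := iterT_weight c eP 0 m; rewrite add0r => <-.
  have [_ _ l1] := param_bounds eP; have /andP[x1 x2] := iterT_inI eP m c0.
  by have /andP[c1 c2] := c0; rewrite ler_norml; lra.
exists k; last first.
  by elim=> [|a w IH]; rewrite ?weight_nil ?mulr0 // mext_cons weight_cat weight_cons kP IH mulrDr.
apply/eqP => k0; have := kP C; rewrite k0 mul0r => /(translation_eq0 eP) E.
by have := eta_nonerasing C; rewrite E.
Qed.

Variable k : R.
Hypothesis k_neq0 : k != 0.
Hypothesis kP : forall w, wt (mext eta w) = k * wt w.

Lemma eta_point i : x_ (size (mext eta (itin 0 i))) = k * x_ i.
Proof.
by rewrite !(iterT_weight c eP) -eta_itinerary kP !add0r.
Qed.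

Lemma eta_reads i w : w = itin (x_ i) (size w) ->
  mext eta w = itin (k * x_ i) (size (mext eta w)).
Proof.
move=> wE; have E : itin 0 (i + size w) = itin 0 i ++ w by rewrite itineraryD -wE.
have := eta_itinerary (i + size w); rewrite E mext_cat size_cat itineraryD => /eqP.
by rewrite eqseq_cat ?size_itinerary // -eta_itinerary eqxx eta_point /= => /eqP.
Qed.

(** Since [eta] multiplies the points of the orbit by [k], it sends what is read on both
    sides of [q] to what is read on both sides of [k * q]; a negative [k]
    exchanges the two sides. *)
Lemma eta_around q g v w : inI q -> c < q -> 0 < g ->
  (forall x, inI x -> q - g < x < q -> v = itin x (size v)) ->
  (forall x, inI x -> q < x < q + g -> w = itin x (size w)) ->
  wt v = wt w ->
  if 0 < k then one_split (mext eta v) (mext eta w) else one_split (mext eta w) (mext eta v).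
Proof.
move=> /andP[q0 q1] cq g0 vP wP vw.
pose N := (maxn (size (mext eta v)) (size (mext eta w))).+1.
have [g' g'0 iso] := cuts_isolated c eP (k * q) N.
have gp := gap_gt0 eP.
pose m := Num.min g' (gap e l / 2).
have m0 : 0 < m by rewrite lt_min g'0; lra.
have k0 : 0 < `|k| by rewrite normr_gt0.
pose r := Num.min g (Num.min (m / `|k|) (Num.min (q - c) (c + l - q))).
have r0 : 0 < r by rewrite !lt_min g0 divr_gt0 //=; lra.
have : r <= r by []; rewrite {2}/r !le_min => /and4P[rg rm r1 r2].
have [i iq] : exists i, q - r < x_ i < q by apply: (forward_dense eP c0); lra.
have [j jq] : exists j, q < x_ j < q + r by apply: (forward_dense eP c0); lra.
have xI n : inI (x_ n) by apply: iterT_inI.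
have vE : v = itin (x_ i) (size v) by apply: vP => //; lra.
have wE : w = itin (x_ j) (size w) by apply: wP => //; lra.
have near n : q - r < x_ n < q + r -> `|k * x_ n - k * q| < m.
  move=> nq; rewrite -mulrBr normrM; apply: (@lt_le_trans _ _ (`|k| * r)).
    by rewrite ltr_pM2l // ltr_norml; lra.
  by rewrite mulrC -ler_pdivlMr.
have kI n : inI (k * x_ n) by rewrite -eta_point.
have read i' j' v' w' : q - r < x_ i' < q + r -> q - r < x_ j' < q + r ->
    k * x_ i' < k * q <= k * x_ j' -> (size (mext eta v') < N)%N -> (size (mext eta w') < N)%N ->
    v' = itin (x_ i') (size v') -> w' = itin (x_ j') (size w') -> wt v' = wt w' ->
    one_split (mext eta v') (mext eta w').
  move=> /near ni /near nj ij v'N w'N v'E w'E vw'.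
  have : m <= m by []; rewrite {2}/m le_min => /andP[mg' mgap].
  move: ni nj; rewrite !ltr_norml => /andP[ni1 ni2] /andP[nj1 nj2].
  apply: (read_around eP b_d_apart (kI i') (kI j') ij (N := N)) => //.
  - by lra.
  - move=> z t zij zq tN; apply: iso => //; first by have := kI i'; have := kI j'; lra.
    by rewrite ltr_norml; lra.
  - exact: eta_reads.
  - exact: eta_reads.
  - by rewrite !kP vw'.
have vN : (size (mext eta v) < N)%N by rewrite ltnS leq_maxl.
have wN : (size (mext eta w) < N)%N by rewrite ltnS leq_maxr.
case: ifP => kpos.
  apply: (read i j) => //; [lra|lra|].
  by rewrite ltr_pM2l // ler_pM2l //; lra.
have kneg : k < 0 by rewrite lt_neqAle k_neq0 leNgt kpos.
apply: (read j i) => //; [lra|lra|].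
by rewrite ltr_nM2l // ler_nM2l //; lra.
Qed.

Lemma eta_around_b : if 0 < k
  then one_split (mext eta [:: A; C]) (eta B) else one_split (eta B) (mext eta [:: A; C]).
Proof.
have [? ? ?] := param_bounds eP; have [/andP[? ?] _ _] := eP.
have : gap e l <= gap e l by []; rewrite {2}/gap !le_min => /and3P[g1 g2 g3].
rewrite -[eta B]mext1; apply: (@eta_around b (gap e l)); rewrite ?b_inI ?gap_gt0 //.
- by lra.
- move=> x xI xb; rewrite !itineraryS.
  have [-> ->] : letter e l c x = A /\ T x = x + 1 - e by case: (pieceP c eP x) => -[]; try lra.
  have [-> _] : letter e l c (x + 1 - e) = C /\ T (x + 1 - e) = x + 1 - e - e by case: (pieceP c eP (x + 1 - e)) => -[]; try lra.
  by [].
- move=> x xI xb; rewrite !itineraryS.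
  have [-> _] : letter e l c x = B /\ T x = x + 1 - 2 * e by case: (pieceP c eP x) => -[]; try lra.
  by [].
- by rewrite !weight_cons weight_nil /=; ring.
Qed.

Lemma eta_around_d : if 0 < k
  then one_split (eta B) (mext eta [:: C; A]) else one_split (mext eta [:: C; A]) (eta B).
Proof.
have [? ? ?] := param_bounds eP; have [/andP[? ?] _ _] := eP.
have : gap e l <= gap e l by []; rewrite {2}/gap !le_min => /and3P[g1 g2 g3].
rewrite -[eta B]mext1; apply: (@eta_around d (gap e l)); rewrite ?d_inI ?gap_gt0 //.
- by lra.
- move=> x xI xb; rewrite !itineraryS.
  have [-> _] : letter e l c x = B /\ T x = x + 1 - 2 * e by case: (pieceP c eP x) => -[]; try lra.
  by [].
- move=> x xI xb; rewrite !itineraryS.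
  have [-> ->] : letter e l c x = C /\ T x = x - e by case: (pieceP c eP x) => -[]; try lra.
  have [-> _] : letter e l c (x - e) = A /\ T (x - e) = x - e + 1 - e by case: (pieceP c eP (x - e)) => -[]; try lra.
  by [].
- by rewrite !weight_cons weight_nil /=; ring.
Qed.

Lemma eta_AC_neq_CA : mext eta [:: A; C] <> mext eta [:: C; A].
Proof.
rewrite !mext2 => /(commute_weight (translation e)).
have [/andP[e0 e1] _ _] := eP.
rewrite -[eta A]mext1 -[eta C]mext1 !kP !weight_cons weight_nil !addr0 /= !mext1 => E.
have sA : 0 < (size (eta A))%:R :> R by rewrite ltr0n lt0n size_eq0 eta_nonerasing.
have sC : 0 < (size (eta C))%:R :> R by rewrite ltr0n lt0n size_eq0 eta_nonerasing.
have : k * ((size (eta C))%:R * (1 - e) + (size (eta A))%:R * e) = 0 by lra.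
move/eqP; rewrite mulf_eq0 (negbTE k_neq0) /= => /eqP.
have := mulr_gt0 sA e0; have e1' : 0 < 1 - e by lra.
by have := mulr_gt0 sC e1'; lra.
Qed.

End Images.

Definition unordered (r : seq abc -> seq abc -> Prop) v w := r v w \/ r w v.

(** The words [eta(AC)] and [eta(CA)] have the same number of letters [B], and [eta(B)] is
    compared with them from opposite sides. From left to right, a splitting at [b] gains
    a letter [B] and a splitting at [d] loses one, so the two comparisons are of
    different kinds. Without any splitting [eta(A)] and [eta(C)] would commute, which is
    impossible for words whose weights have opposite signs. *)
Lemma eta_splits (R : realType) (e l c : R) (u : biword abc) (eta : wmorph abc abc) :
  is_3iet_word e l c u -> apart e l c -> nonerasing eta -> fixes eta u ->
  (unordered split_b (mext eta [:: A; C]) (eta B) /\ unordered split_d (mext eta [:: C; A]) (eta B)) \/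
  (unordered split_d (mext eta [:: A; C]) (eta B) /\ unordered split_b (mext eta [:: C; A]) (eta B)).
Proof.
move=> uP sep etaN [_ etau]; have [k k0 kP] := eta_scales uP sep etaN etau.
have := eta_around_b uP sep etau k0 kP; have := eta_around_d uP sep etau k0 kP.
have AC := eta_AC_neq_CA uP etaN k0 kP.
pose n w := count_mem B w.
have nAC : n (mext eta [:: A; C]) = n (mext eta [:: C; A]).
  by rewrite /n !mext2 !count_cat addnC.
have nb v w : split_b v w -> n w = (n v).+1.
  by move=> [w1 [w2 [-> ->]]]; rewrite /n !count_cat /=; clear; lia.
have nd v w : split_d v w -> n v = (n w).+1.
  by move=> [w1 [w2 [-> ->]]]; rewrite /n !count_cat /=; clear; lia.
move: AC nAC; move: (mext eta [:: A; C]) (mext eta [:: C; A]) (eta B) => v w x vw nvw.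
by case: (0 < k)%R => -[E|h|h] -[E'|h'|h'];
   rewrite /unordered; first [by left; split; by [left|right] | by right; split; by [left|right] |
     exfalso; try (have := nb _ _ h); try (have := nd _ _ h); try (have := nb _ _ h'); try (have := nd _ _ h');
     try (subst; by []); subst; clear -nvw; lia].
Qed.

(** * Ternarization *)

Lemma split_b_sigma v w : unordered split_b v w ->
  mext sigma01 v = mext sigma01 w /\ swapped (mext sigma10 v) (mext sigma10 w).
Proof.
have H v' w' : split_b v' w' ->
    mext sigma01 v' = mext sigma01 w' /\ swapped (mext sigma10 v') (mext sigma10 w').
  move=> [w1 [w2 [-> ->]]]; rewrite !mext_cat; split=> //.
  by exists false, (mext sigma10 w1), (mext sigma10 w2).
by case=> /H[E S] //; split=> //; apply: swapped_sym.
Qed.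

Lemma split_d_sigma v w : unordered split_d v w ->
  mext sigma10 v = mext sigma10 w /\ swapped (mext sigma01 v) (mext sigma01 w).
Proof.
have H v' w' : split_d v' w' ->
    mext sigma10 v' = mext sigma10 w' /\ swapped (mext sigma01 v') (mext sigma01 w').
  move=> [w1 [w2 [-> ->]]]; rewrite !mext_cat; split=> //.
  by exists false, (mext sigma01 w1), (mext sigma01 w2).
by case=> /H[E S] //; split=> //; apply: swapped_sym.
Qed.

Lemma ter_unique v w x : is_ternarization v w x -> ter v w = x.
Proof.
move=> h; have := @xgetPex _ [::] (is_ternarization v w) (ex_intro _ x h).
by move=> h'; apply: is_ternarization_inj h' h.
Qed.

(** The fixed point is the image of [u] by [s]. *)
Lemma semiconj_fixed_point (X Y : eqType) (f : wmorph X X) (g : wmorph Y Y)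
    (s : wmorph X Y) u : nonerasing s -> nonerasing g ->
  (forall a, mext s (f a) = mext g (s a)) -> fixes f u -> exists v, fixes g v.
Proof.
move=> sN gN sf fu; have [v uv] := bi_image_exists u sN.
have [v' vv'] := bi_image_exists v gN; exists v.
have E : mcomp s f = mcomp g s by apply/funext.
have h1 := bi_image_comp fu uv; have h2 := bi_image_comp uv vv'.
rewrite E in h1; have vE : v' = v by apply/funext; apply: bi_image_unique h2 h1.
by rewrite /fixes -{2}vE.
Qed.

Lemma ternarization_of (xi : wmorph abc abc) (phi psi : wmorph bool bool) :
  (forall a, mext sigma01 (xi a) = mext phi (sigma01 a)) ->
  (forall a, mext sigma10 (xi a) = mext psi (sigma10 a)) ->
  amicable_morph phi psi /\ xi =1 ter_morph phi psi.
Proof.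
move=> h01 h10.
have tA : is_ternarization (phi false) (psi false) (xi A).
  by split; rewrite ?h01 ?h10 /= mext1.
have tC : is_ternarization (phi true) (psi true) (xi C).
  by split; rewrite ?h01 ?h10 /= mext1.
have tB : is_ternarization (mext phi [:: false; true]) (mext psi [:: true; false]) (xi B).
  by split; rewrite ?h01 ?h10.
split; first by split; [exists (xi A)|exists (xi C)|exists (xi B)].
by case=> /=; rewrite (ter_unique tA, ter_unique tB, ter_unique tC).
Qed.

Lemma mext_semiconj (X Y Z W : Type) (f : wmorph X Y) (s : wmorph Y W) (g : wmorph Z W) (t : wmorph X Z) :
  (forall a, mext s (f a) = mext g (t a)) -> forall w, mext s (mext f w) = mext g (mext t w).
Proof. by move=> h w; rewrite -!mext_mcomp; apply: eq_mext. Qed.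

Theorem theorem11 (R : realType) (e l c : R)
    (u : biword abc) (eta : wmorph abc abc) :
  is_3iet_word e l c u -> nondegenerate_3iet u ->
  primitive_morphism eta -> fixes eta u ->
  exists phi psi : wmorph bool bool,
    [/\ sturmian_morphism phi /\ sturmian_morphism psi,
        (exists v : biword bool, fixes phi v) /\
        (exists v : biword bool, fixes psi v),
        amicable_morph phi psi &
        (eta =1 ter_morph phi psi \/ mcomp eta eta =1 ter_morph phi psi)].
Proof.
move=> uP nd /primitive_nonerasing etaN etau.
have sep := nondegenerate_apart uP nd.
pose lift (s : wmorph abc bool) : wmorph bool bool := fun x => mext s (eta (if x then C else A)).
have liftE s : lift s false ++ lift s true = mext s (mext eta [:: A; C]) /\
    lift s true ++ lift s false = mext s (mext eta [:: C; A]).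
  by rewrite !mext2 !mext_cat.
set phi := lift sigma01; set psi := lift sigma10.
have s01N := sigma01_nonerasing.
have s10N : nonerasing sigma10 by case.
have [[/split_b_sigma[b1 b2] /split_d_sigma[d1 d2]]|[/split_d_sigma[d1 d2] /split_b_sigma[b1 b2]]] :=
    eta_splits uP sep etaN etau.
- have phiS : swaps_once phi.
    by rewrite /swaps_once (liftE _).1 (liftE _).2 b1; apply: swapped_sym.
  have psiS : swaps_once psi.
    by rewrite /swaps_once (liftE _).1 (liftE _).2 d1.
  have h01 a : mext sigma01 (eta a) = mext phi (sigma01 a).
    by case: a; rewrite /= ?mext1 //; rewrite -b1 -(liftE _).1 mext2.
  have h10 a : mext sigma10 (eta a) = mext psi (sigma10 a).
    by case: a; rewrite /= ?mext1 //; rewrite -d1 -(liftE _).2 mext2.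
  have [ami ter] := ternarization_of h01 h10.
  exists phi, psi; split=> //; [|split|by left].
  - by split; apply: swaps_once_sturmian.
  - exact: semiconj_fixed_point (swaps_once_nonerasing phiS) h01 etau.
  - exact: semiconj_fixed_point (swaps_once_nonerasing psiS) h10 etau.
have phiS : swaps_once phi.
  by rewrite /swaps_once (liftE _).1 (liftE _).2 b1.
have psiS : swaps_once psi.
  by rewrite /swaps_once (liftE _).1 (liftE _).2 d1; apply: swapped_sym.
have h01 a : mext sigma01 (eta a) = mext phi (sigma10 a).
  by case: a; rewrite /= ?mext1 //; rewrite -b1 -(liftE _).2 mext2.
have h10 a : mext sigma10 (eta a) = mext psi (sigma01 a).
  by case: a; rewrite /= ?mext1 //; rewrite -d1 -(liftE _).1 mext2.
have h01' a : mext sigma01 (mcomp eta eta a) = mext (mcomp phi psi) (sigma01 a).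
  by rewrite (mext_mcomp psi phi) -h10; apply: mext_semiconj h01 _.
have h10' a : mext sigma10 (mcomp eta eta a) = mext (mcomp psi phi) (sigma10 a).
  by rewrite (mext_mcomp phi psi) -h01; apply: mext_semiconj h10 _.
have etau2 : fixes (mcomp eta eta) u := bi_image_comp etau etau.
have [ami ter] := ternarization_of h01' h10'.
have phiN := swaps_once_nonerasing phiS; have psiN := swaps_once_nonerasing psiS.
exists (mcomp phi psi), (mcomp psi phi); split=> //; [|split|by right].
- by split; apply: sturmian_mcomp; apply: swaps_once_sturmian.
- exact: semiconj_fixed_point (nonerasing_mcomp psiN phiN) h01' etau2.
- exact: semiconj_fixed_point (nonerasing_mcomp phiN psiN) h10' etau2.
Qed.
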